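(* For all $X,Y\in\mathcal{G}_w$ and all $p,q\in[1,\infty]$, $$2\,d_{\mathrm{GW}p,q}(X,Y)\ \ge\ \mathrm{TLB}_{p,q}(X,Y)\ \ge\ \mathrm{SLB}_{p,q}(X,Y)\ \ge\ \mathrm{DLB}_{p,p\wedge q}(X,Y),$$ where $p\wedge q$ denotes $\min\{p,q\}$.
   Context: $\mathcal{G}_w$ is the collection of metric measure spaces: triples $(X,d_X,\mu_X)$ with $(X,d_X)$ a compact metric space and $\mu_X$ a Borel probability measure on $X$ with $\mathrm{supp}[\mu_X]=X$. $\mathcal{M}(\alpha,\beta)$ denotes the set of couplings of $\alpha$ and $\beta$ (probability measures on the product space with marginals $\alpha,\beta$). $\mathbb{R}_+=[0,\infty)$, and $\#$ denotes pushforward. For $a,b\ge0$: $\Lambda_q(a,b):=|a^q-b^q|^{1/q}$ if $q<\infty$; $\Lambda_\infty(a,b):=\max\{a,b\}$ if $a\ne b$ and $\Lambda_\infty(a,a):=0$. Each $\Lambda_q$ is a metric on $\mathbb{R}_+$. $(p,q)$-Gromov-Wasserstein distance: $d_{\mathrm{GW}p,q}(X,Y):=\frac12\inf_{\gamma\in\mathcal{M}(\mu_X,\mu_Y)}\mathrm{dis}_{p,q}(\gamma)$, where $$\mathrm{dis}_{p,q}(\gamma):=\left(\int_{X\times Y}\int_{X\times Y}\big(\Lambda_q(d_X(x,x'),d_Y(y,y'))\big)^p\,\gamma(dx\times dy)\,\gamma(dx'\times dy')\right)^{1/p}$$ for $p<\infty$, and $\mathrm{dis}_{\infty,q}(\gamma):=\sup_{(x,y),(x',y')\in\mathrm{supp}[\gamma]}\Lambda_q(d_X(x,x'),d_Y(y,y'))$.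 Wasserstein distance on $(\mathbb{R}_+,\Lambda_q)$: for compactly supported Borel probability measures $\alpha,\beta$ on $\mathbb{R}_+$ (usual Borel structure), $$d^{(\mathbb{R}_+,\Lambda_q)}_{\mathrm{W}p}(\alpha,\beta):=\inf_{\gamma\in\mathcal{M}(\alpha,\beta)}\left(\int_{\mathbb{R}_+\times\mathbb{R}_+}\big(\Lambda_q(a,b)\big)^p\,\gamma(da\times db)\right)^{1/p}\ (p<\infty),$$ $$d^{(\mathbb{R}_+,\Lambda_q)}_{\mathrm{W}\infty}(\alpha,\beta):=\inf_{\gamma\in\mathcal{M}(\alpha,\beta)}\sup_{(a,b)\in\mathrm{supp}[\gamma]}\Lambda_q(a,b).$$ Distance distributions: the local distribution of distances measure at $x\in X$ is $dh_X(x):=(d_X(x,\cdot))_\#\mu_X$, and the global one is $dH_X:=(d_X)_\#(\mu_X\otimes\mu_X)$; both are probability measures on $\mathbb{R}_+$. Third Lower Bound: $$\mathrm{TLB}_{p,q}(X,Y):=\inf_{\gamma\in\mathcal{M}(\mu_X,\mu_Y)}\left(\int_{X\times Y}\Big(d^{(\mathbb{R}_+,\Lambda_q)}_{\mathrm{W}p}(dh_X(x),dh_Y(y))\Big)^p\gamma(dx\times dy)\right)^{1/p}\ (p<\infty),$$ $$\mathrm{TLB}_{\infty,q}(X,Y):=\inf_{\gamma\in\mathcal{M}(\mu_X,\mu_Y)}\sup_{(x,y)\in\mathrm{supp}[\gamma]}d^{(\mathbb{R}_+,\Lambda_q)}_{\mathrm{W}\infty}(dh_X(x),dh_Y(y)).$$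 Second Lower Bound: $\mathrm{SLB}_{p,q}(X,Y):=d^{(\mathbb{R}_+,\Lambda_q)}_{\mathrm{W}p}(dH_X,dH_Y)$. Diameter Lower Bound: $\mathrm{DLB}_{p,q}(X,Y):=\Lambda_q(\mathrm{diam}_p(X),\mathrm{diam}_p(Y))$, where $\mathrm{diam}_p(X):=\left(\int_X\int_X d_X^p(x,x')\,\mu_X(dx)\,\mu_X(dx')\right)^{1/p}$ for $p<\infty$, and $\mathrm{diam}_\infty(X):=\sup_{x,x'\in\mathrm{supp}[\mu_X]}d_X(x,x')$. *)

(* Defs.v *)
From HB Require Import structures.
From mathcomp Require Import all_boot all_order all_algebra.
From mathcomp Require Import all_classical all_reals all_analysis.
From mathcomp Require Import lra.

Set Implicit Arguments.
Unset Strict Implicit.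
Unset Printing Implicit Defensive.

Import Order.TTheory GRing.Theory Num.Theory.
Import numFieldNormedType.Exports.
Import measurable_realfun.

Local Open Scope classical_set_scope.
Local Open Scope ring_scope.

(* [measurableType] requires a base point; it carries no extra content here,
   since a space that supports a probability measure is not empty. *)
#[short(type="pmetricType")]
HB.structure Definition PointedMetric (R : numDomainType) :=
  {T of Pointed T & Metric R T}.

Notation borel T := (g_sigma_algebraType (@open T)).

Section measurability.
Context {R : realType}.

Lemma open_measurable_borel (T : ptopologicalType) (A : set T) :
  open A -> measurable (A : set (borel T)).
Proof. exact: sub_sigma_algebra. Qed.

Lemma open_measurable_prod (S T : ptopologicalType) (A : set (S * T)) :
  @second_countable S -> @second_countable T -> open A ->
  measurable (A : set (borel S * borel T)).
Proof.
move=> [B cB [oB bB]] [C cC [oC bC]] oA.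
pose F (W : set S * set T) : set (borel S * borel T) :=
  if `[< [/\ B W.1, C W.2 & W.1 `*` W.2 `<=` A] >] then W.1 `*` W.2 else set0.
have -> : A = \bigcup_(W in B `*` C) F W.
  apply/seteqP; split => [[x y] Axy|z [W [BW CW]]]; last first.
    by rewrite /F; case: asboolP => // -[_ _]; exact.
  have : nbhs ((x, y) : S * T) A by exact: open_nbhs_nbhs.
  move=> [[U V]/= [/bB[U' [BU' U'x] U'U] /bC[V' [CV' V'y] V'V]] UVA].
  exists (U', V') => //; rewrite /F; case: asboolP => //= -[]; split => //.
  by move=> -[x' y'] [/= /U'U ? /V'V ?]; exact: UVA.
have /pfcard_geP[->|[g]] : countable (B `*` C) by exact: countableX.
  by rewrite bigcup_set0.
rewrite -(image_eq g) bigcup_image; apply: bigcupT_measurable => n; rewrite /F.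
case: asboolP => // -[/oB oU /oC oV _].
by apply: measurableX; exact: open_measurable_borel.
Qed.

Lemma continuous_mdist (T : metricType R) :
  continuous (fun z : T * T => mdist z.1 z.2).
Proof.
move=> [x y]; apply/cvgrPdist_lt => e e0.
have e20 : 0 < e / 2 by rewrite divr_gt0.
exists (ball x (e / 2), ball y (e / 2)); first by split; exact: nbhsx_ballx.
move=> [x' y']; rewrite !ballEmdist => -[/= xx' yy'].
rewrite (splitr e); apply: le_lt_trans (ltrD xx' yy').
have := metric_triangle x x' y; have := metric_triangle x' y' y.
have := metric_triangle x' x y'; have := metric_triangle x y y'.
rewrite (metric_sym x' x) (metric_sym y' y) ler_norml => *.
by apply/andP; split; lra.
Qed.

Lemma measurable_mdist (T : pmetricType R) : compact [set: T] ->
  measurable_fun [set: borel T * borel T]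
    (fun z : borel T * borel T => mdist (z.1 : T) z.2).
Proof.
move=> cT; apply: (measurability _ (RGenOpens.measurableE R)).
move=> _ [_ [a [b ->] <-]]; rewrite setTI.
have sT : @second_countable T by exact: (@compact_second_countable R).
apply: open_measurable_prod => //.
have /continuousP c := @continuous_mdist T.
exact/c/interval_open.
Qed.

Lemma measurable_mdistr (T : pmetricType R) (x : T) :
  measurable_fun [set: borel T] (fun y : borel T => mdist x (y : T)).
Proof.
apply: (measurability _ (RGenOpens.measurableE R)).
move=> _ [_ [a [b ->] <-]]; rewrite setTI; apply: open_measurable_borel.
have c : continuous (fun y : T => mdist x y).
  move=> y.
  have xy : (x, z) @[z --> y] --> ((x, y) : T * T).
    exact: (cvg_pair (cvg_cst x) cvg_id).
  exact: (cvg_comp _ _ xy (@continuous_mdist T (x, y))).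
by move/continuousP in c; exact/c/interval_open.
Qed.

End measurability.

(* When applied to a coupling, [mu] is defined on a product sigma-algebra. It
   still makes sense on every open set: see [open_measurable_prod]. *)
Definition supp (R : realType) (T : topologicalType) (mu : set T -> \bar R) :
  set T := [set x | forall U, open_nbhs x U -> (0 < mu U)%E].

Record mmspace (R : realType) := MMSpace {
  mm_sort :> pmetricType R;
  mm_measure : probability (borel mm_sort) R;
  mm_compact : compact [set: mm_sort];
  mm_supp : supp (mm_measure : set mm_sort -> \bar R) = [set: mm_sort] }.

Definition coupling d1 d2 (T1 : measurableType d1) (T2 : measurableType d2)
    (R : realType) (alpha : probability T1 R) (beta : probability T2 R) :
    set (probability (T1 * T2)%type R) :=
  [set gamma | (forall A, measurable A -> pushforward gamma fst A = alpha A) /\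
               (forall B, measurable B -> pushforward gamma snd B = beta B)].

(* The exponents range over [1, +oo] in [\bar R]. In each [match] below the
   last branch is the case [+oo]; it also absorbs the irrelevant [-oo]. *)
Definition Lambda (R : realType) (q : \bar R) (a b : R) : R :=
  match q with
  | EFin r => `|a `^ r - b `^ r| `^ r^-1
  | _ => if a == b then 0 else Num.max a b
  end.

Section bounds.
Context {R : realType}.
Implicit Types (p q : \bar R) (X Y : mmspace R).
Local Open Scope ereal_scope.

Definition quadrant : set (R * R) := `[0%R, +oo[ `*` `[0%R, +oo[.

(* Measures on [0, +oo[ are represented by measures on [R] that are
   concentrated on [0, +oo[. *)
Definition wasserstein p q (alpha beta : probability R R) : \bar R :=
  match p with
  | EFin r => ereal_inf
      [set (\int[gamma]_(z in quadrant) ((Lambda q z.1 z.2) `^ r)%:E) `^ r^-1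
      | gamma in coupling alpha beta]
  | _ => ereal_inf
      [set ereal_sup [set (Lambda q z.1 z.2)%:E
                     | z in supp (gamma : set (R * R) -> \bar R) `&` quadrant]
      | gamma in coupling alpha beta]
  end.

Definition dist_from X (x : X) : borel X -> R := fun x' => mdist x x'.

HB.instance Definition _ X (x : X) :=
  isMeasurableFun.Build _ _ _ _ (dist_from x) (measurable_mdistr x).

Definition dist_pair X : borel X * borel X -> R :=
  fun z => mdist (z.1 : X) z.2.

HB.instance Definition _ X :=
  isMeasurableFun.Build _ _ _ _ (@dist_pair X)
    (measurable_mdist (@mm_compact R X)).

Definition dh X (x : X) : probability R R :=
  distribution (mm_measure X) (dist_from x).

Definition dH X : probability R R :=
  distribution (mm_measure X \x mm_measure X) (@dist_pair X).

Definition distortion p q X Y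
    (gamma : probability (borel X * borel Y)%type R) : \bar R :=
  match p with
  | EFin r =>
      (\int[gamma]_z \int[gamma]_z'
         ((Lambda q (mdist (z.1 : X) z'.1) (mdist (z.2 : Y) z'.2)) `^ r)%:E)
      `^ r^-1
  | _ => let S := supp (gamma : set (X * Y) -> \bar R) in
      ereal_sup [set (Lambda q (mdist (zz.1.1 : X) zz.2.1)
                               (mdist (zz.1.2 : Y) zz.2.2))%:E
                | zz in S `*` S]
  end.

Definition dGW p q X Y : \bar R :=
  (2^-1)%:E * ereal_inf [set distortion p q gamma
                        | gamma in coupling (mm_measure X) (mm_measure Y)].

Definition TLB p q X Y : \bar R :=
  match p with
  | EFin r => ereal_inf
      [set (\int[gamma]_z (wasserstein p q (dh (z.1 : X)) (dh (z.2 : Y))) `^ r)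
           `^ r^-1
      | gamma in coupling (mm_measure X) (mm_measure Y)]
  | _ => ereal_inf
      [set ereal_sup [set wasserstein p q (dh z.1) (dh z.2)
                     | z in supp (gamma : set (X * Y) -> \bar R)]
      | gamma in coupling (mm_measure X) (mm_measure Y)]
  end.

Definition SLB p q X Y : \bar R := wasserstein p q (dH X) (dH Y).

Definition diam p X : \bar R :=
  match p with
  | EFin r =>
      (\int[mm_measure X]_x \int[mm_measure X]_x'
         ((mdist (x : X) x') `^ r)%:E) `^ r^-1
  | _ => let S := supp (mm_measure X : set X -> \bar R) in
      ereal_sup [set (mdist (xx.1 : X) xx.2)%:E | xx in S `*` S]
  end.

(* [fine] only changes the type here: the diameters are finite because the
   spaces are compact. *)
Definition DLB p q X Y : \bar R :=
  (Lambda q (fine (diam p X)) (fine (diam p Y)))%:E.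

End bounds.

(* Main.v *)
Require Import Defs.
From HB Require Import structures.
From mathcomp Require Import all_boot all_order all_algebra.
From mathcomp Require Import all_classical all_reals all_analysis.
From mathcomp Require Import lra giry.

(** The three inequalities compare infima of transport costs, so each one is
    obtained by turning a coupling for the larger side into a coupling for the
    smaller side.

    2 dGW >= TLB. For a coupling [gamma] of [X] and [Y] and a fixed pair
    [z = (x, y)], the map [z' |-> (d(x, x'), d(y, y'))] pushes [gamma] forward to
    a coupling of [dh x] and [dh y]. Hence the inner integral of the distortion
    dominates the p-th power of the Wasserstein distance of [dh x] and [dh y]
    ([wasserstein_dh_le]). For [p = +oo] integrals become suprema over supports,
    and one uses that, by compactness, the support of the pushforward is
    contained in the image of the support ([supp_pushforward_sub]).

    TLB >= SLB. One has to glue couplings of [dh x] and [dh y], along [gamma],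
    into a coupling of [dH X] and [dH Y] ([glued_coupling]). The textbook
    argument selects optimal couplings measurably in [(x, y)]. Here X x Y is cut
    instead into countably many cells of diameter less than e, one coupling
    optimal up to e for the whole cell is kept in each of them, and these
    couplings are averaged. The averaged measure has almost the right cost, but
    its marginals are only almost [dH X] and [dH Y]; both defects vanish as e
    tends to 0, provided that one can pass to the limit. The cost is not
    continuous ([Lambda +oo] jumps on the diagonal) but it is lower
    semicontinuous, and this is enough: a limit [P] is needed such that [P G] is
    at most the limit of the masses of [G] for every open [G].

    Such a limit exists along any ultrafilter ([probability_ultralimit]): the
    limits of the masses form a finitely additive function, its restriction to
    compact sets is a content, and the outer measure induced by a content is a
    Borel measure by Caratheodory's theorem
    ([compact_content_outer_measure]). The inequality on open sets gives the
    marginals, tested on open rays ([ultralimit_marginal]), and bounds the cost,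
    written as a stack of indicators of open sets ([ultralimit_integral]).
    The case [p = +oo] is the same statement for the indicator of the open set
    where the cost exceeds a given level.

    SLB >= DLB. The diameter [diam p] is the L^p norm of the identity under
    [dH]. Since [Lambda q] increases with [q] ([le_Lambda]), [q] may be lowered to
    [m = min p q]; then [Lambda m a b] is a power of [|a ^ m - b ^ m|] and the
    triangle inequality in L^(p/m) concludes ([reverse_minkowski]). For
    [p = +oo] the larger diameter is attained at a point of the support of any
    coupling, whose other coordinate is at most the smaller diameter. *)

Set Implicit Arguments.
Unset Strict Implicit.
Unset Printing Implicit Defensive.

Import Order.TTheory GRing.Theory Num.Theory.
Import numFieldNormedType.Exports.
Import measurable_realfun.

Local Open Scope classical_set_scope.
Local Open Scope ring_scope.
Local Open Scope ereal_scope.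

(** * Outer measures induced by contents on compact sets *)

Section compact_content.
Context {R : realType} {T : topologicalType}.
Implicit Types (A B C G H : set T).

(** The value on an open set [G] of the measure induced by the content [l],
    namely its compact inner approximation. *)
Definition inner_content (l : set T -> R) G : \bar R :=
  ereal_sup [set (l C)%:E | C in [set C | compact C /\ C `<=` G]].

Definition outer_content (l : set T -> R) A : \bar R :=
  ereal_inf [set inner_content l G | G in [set G | open G /\ A `<=` G]].

Variable l : set T -> R.
Hypothesis hT : hausdorff_space T.
Hypothesis nT : normal_space T.
Hypothesis l0 : l set0 = 0%R.
Hypothesis lU : forall A B, compact A -> compact B ->
  (l (A `|` B) <= l A + l B)%R.
Hypothesis lUI : forall A B, compact A -> compact B -> A `&` B = set0 ->
  l (A `|` B) = (l A + l B)%R.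

Lemma inner_content_ge C G : compact C -> C `<=` G ->
  (l C)%:E <= inner_content l G.
Proof. by move=> cC CG; apply: ereal_sup_ubound; exists C. Qed.

Lemma inner_content_ge0 G : 0 <= inner_content l G.
Proof. by rewrite -[0]/(0%R%:E) -l0; apply: inner_content_ge => //; exact: compact0. Qed.

(** The parts of [C] outside [G] and outside [H] are disjoint closed sets;
    removing disjoint neighbourhoods of them from [C] leaves the two pieces. *)
Lemma compact_subsetU C G H : compact C -> open G -> open H ->
  C `<=` G `|` H -> exists C1 C2, [/\ compact C1, compact C2, C1 `<=` G,
    C2 `<=` H & C = C1 `|` C2].
Proof.
move=> cC oG oH CGH.
have clC := compact_closed hT cC.
have [|||U [V [oU oV CGU CHV UV]]] :=
  (@normal_openP R T).1 nT (C `&` ~` G) (C `&` ~` H).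
- by apply: closedI => //; exact: open_closedC.
- by apply: closedI => //; exact: open_closedC.
- by rewrite -subset0 => x [[Cx nGx] [_ nHx]]; have [] := CGH _ Cx.
exists (C `&` ~` U), (C `&` ~` V); split.
- by apply: compact_closedI => //; exact: open_closedC.
- by apply: compact_closedI => //; exact: open_closedC.
- by move=> x [Cx nUx]; apply: contrapT => nGx; exact/nUx/CGU.
- by move=> x [Cx nVx]; apply: contrapT => nHx; exact/nVx/CHV.
- by rewrite -setIUr -setCI UV setC0 setIT.
Qed.

Lemma inner_contentU G H : open G -> open H ->
  inner_content l (G `|` H) <= inner_content l G + inner_content l H.
Proof.
move=> oG oH; apply: ge_ereal_sup => _ [C [cC CGH] <-].
have [C1 [C2 [cC1 cC2 C1G C2H ->]]] := compact_subsetU cC oG oH CGH.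
apply: (@le_trans _ _ (l C1 + l C2)%:E); first by rewrite lee_fin lU.
by rewrite EFinD leeD// inner_content_ge.
Qed.

(** A compact subset of the union lies in finitely many of the open sets, so that
    countable subadditivity reduces to finite subadditivity. *)
Lemma inner_content_bigcup (G : (set T)^nat) : (forall n, open (G n)) ->
  inner_content l (\bigcup_n G n) <= \sum_(i <oo) inner_content l (G i).
Proof.
move=> oG; apply: ge_ereal_sup => _ [C [cC CG] <-].
have [N CN] : exists N, C `<=` \big[setU/set0]_(i < N) G i.
  have /compact_near_coveringP/(_ nat \oo
    (fun n x => (\big[setU/set0]_(i < n) G i) x) _) := cC.
  case=> [x Cx|N _ NC]; last by exists N; exact: (NC N (leqnn N)).
  have [k _ Gkx] := CG _ Cx.
  exists (G k, [set n | (k < n)%N]) => /=.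
    by split; [exact: open_nbhs_nbhs|exact: nbhs_infty_gt].
  by move=> -[y n]/= [Gky kn]; rewrite -bigcup_mkord; exists k.
apply: (@le_trans _ _ (\sum_(0 <= i < N) inner_content l (G i))); last first.
  by apply: nneseries_lim_ge => i _ _; exact: inner_content_ge0.
apply: (@le_trans _ _ (inner_content l (\big[setU/set0]_(i < N) G i))).
  exact: inner_content_ge.
rewrite big_mkord; elim: N {CN} => [|N IH].
  rewrite !big_ord0; apply: ge_ereal_sup => _ [D [_ D0] <-].
  by rewrite (_ : D = set0) ?l0// -subset0.
rewrite !big_ord_recr/=; apply: le_trans (leeD IH (lexx _)).
by apply: inner_contentU => //; rewrite -bigcup_mkord; exact: bigcup_open.
Qed.

Lemma outer_content_le A G : open G -> A `<=` G ->
  outer_content l A <= inner_content l G.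
Proof. by move=> oG AG; apply: ereal_inf_lbound; exists G. Qed.

Lemma outer_content_ge0 A : 0 <= outer_content l A.
Proof. by apply: le_ereal_inf_tmp => _ [G _ <-]; exact: inner_content_ge0. Qed.

Lemma outer_content0 : outer_content l set0 = 0.
Proof.
apply/eqP; rewrite eq_le outer_content_ge0 andbT.
apply: (le_trans (outer_content_le open0 (@subset_refl _ _))).
by apply: ge_ereal_sup => _ [D [_ D0] <-]; rewrite (_ : D = set0) ?l0// -subset0.
Qed.

(** Each set of finite outer content is covered by an open set at the price of
    e / 2^(n+1); the open covers are then handled by [inner_content_bigcup]. *)
Lemma outer_content_subset_sigma_subadditive A (F : (set T)^nat) :
  subset_sigma_subadditive (outer_content l) A F.
Proof.
move=> AF.
have [[n Fn]|Fy] := pselect (exists n, outer_content l (F n) = +oo).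
  rewrite (_ : \sum_(_ <oo) _ = +oo) ?leey//.
  apply/eqP; rewrite -leye_eq -[leLHS]Fn.
  apply: (@le_trans _ _ (\sum_(0 <= i < n.+1) outer_content l (F i))).
    rewrite big_nat_recr//= leeDr//; apply: sume_ge0 => i _.
    exact: outer_content_ge0.
  by apply: nneseries_lim_ge => i _ _; exact: outer_content_ge0.
apply/lee_addgt0Pr => e e0.
apply: le_trans (epsilon_trick xpredT _ (ltW e0)); last first.
  by move=> n; exact: outer_content_ge0.
have /choice[G HG] n : exists G, [/\ open G, F n `<=` G &
    inner_content l G <= outer_content l (F n) + (e / (2 ^ n.+1)%:R)%:E].
  have en0 : (0 < e / (2 ^ n.+1)%:R)%R by rewrite divr_gt0// ltr0n expn_gt0.
  have fF : outer_content l (F n) \is a fin_num.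
    rewrite ge0_fin_numE ?outer_content_ge0// ltey; apply/eqP => ?.
    by apply: Fy; exists n.
  by have [_ [G [oG FG] <-] /ltW ?] := lb_ereal_inf_adherent en0 fF; exists G.
apply: (@le_trans _ _ (inner_content l (\bigcup_n G n))).
  apply: outer_content_le.
    by apply: bigcup_open => n _; have [] := HG n.
  move=> x /AF[n _ Fnx]; exists n => //.
  by have [_ + _] := HG n; exact.
apply: le_trans (inner_content_bigcup _) _ => [n|]; first by have [] := HG n.
apply: lee_nneseries => [n _ _|n _]; first exact: inner_content_ge0.
by have [] := HG n.
Qed.

#[local] HB.instance Definition _ := isSubsetOuterMeasure.Build R T (outer_content l)
  outer_content0 outer_content_ge0 outer_content_subset_sigma_subadditive.

Lemma inner_content_ge_approx G (e : R) : (0 < e)%R ->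
  (exists M, forall C, compact C -> (l C <= M)%R) ->
  exists C, [/\ compact C, C `<=` G & inner_content l G <= (l C + e)%:E].
Proof.
move=> e0 [M lM].
have fG : inner_content l G \is a fin_num.
  rewrite ge0_fin_numE ?inner_content_ge0//; apply: (@le_lt_trans _ _ M%:E).
    by apply: ge_ereal_sup => _ [C [cC _] <-]; rewrite lee_fin lM.
  by rewrite ltry.
have [_ [C [cC CG] <-] lC] := ub_ereal_sup_adherent e0 fG.
by exists C; split => //; rewrite EFinD -leeBlDr// ltW.
Qed.

(** Exhaust [H `&` G] by a compact set [C], then [H `\` C] by a compact set [D]:
    these are disjoint, so that their contents add up to at most the inner
    content of [H], while [H `\` C] still covers the part of [X] outside [G]. *)
Lemma open_caratheodory G :
  (exists M, forall C, compact C -> (l C <= M)%R) ->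
  open G -> (outer_content l).-caratheodory G.
Proof.
move=> lM oG; apply: le_caratheodory_measurable => X /=.
apply: le_ereal_inf_tmp => _ [H [oH XH] <-].
apply/lee_addgt0Pr => e e0.
have e20 : (0 < e / 2)%R by rewrite divr_gt0.
have [C [cC CHG HC]] := inner_content_ge_approx (H `&` G) e20 lM.
have clC := compact_closed hT cC.
have [D [cD DHC HD]] := inner_content_ge_approx (H `&` ~` C) e20 lM.
have CD : C `&` D = set0.
  by rewrite -subset0 => x [Cx /DHC[]].
apply: (@le_trans _ _ ((l C + e / 2)%:E + (l D + e / 2)%:E)).
  apply: leeD.
    apply: le_trans HC; apply: outer_content_le; first exact: openI.
    by move=> x [/XH ? ?].
  apply: le_trans HD; apply: outer_content_le.
    by apply: openI => //; exact: closed_openC.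
  by move=> x [/XH ? nGx]; split => // /CHG[].
rewrite -EFinD addrACA -splitr EFinD leeD2r// -lUI//.
apply: inner_content_ge; first exact: compactU.
by move=> x [/CHG[]|/DHC[]].
Qed.

(** The outer measure is packaged existentially because its structure depends on
    the properties of [l]. *)
Lemma compact_content_outer_measure :
  (exists M, forall C, compact C -> (l C <= M)%R) ->
  exists mu : {outer_measure set T -> \bar R},
    (mu : set T -> \bar R) = outer_content l /\
    forall G, open G -> mu.-caratheodory G.
Proof.
by move=> lM; exists (outer_content l); split => // G; exact: open_caratheodory.
Qed.

End compact_content.

(** * Limits of probability measures on the plane *)

Section plane.
Context {R : realType}.

Lemma second_countable_real : @second_countable R.
Proof.
exists [set (`](ratr ab.1), ratr ab.2[%classic : set R) |
  ab in [set: rat * rat]].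
  exact: (sub_countable (card_image_le _ _)).
split=> [_ [ab _ <-]|x V]; first exact: interval_open.
move/nbhs_ballP => [e /= e0 xeV].
have [a] : exists q : rat, ratr q \in `](x - e)%R, x[%R.
  by apply: rat_in_itvoo; rewrite ltrBlDr ltrDl.
rewrite in_itv/= => /andP[ea ax].
have [b] : exists q : rat, ratr q \in `]x, (x + e)%R[%R.
  by apply: rat_in_itvoo; rewrite ltrDl.
rewrite in_itv/= => /andP[xb be].
exists (`](ratr a), ratr b[%classic : set R) => /=.
  by split; [exists (a, b)|rewrite in_itv/= ax].
move=> y; rewrite /= in_itv/= => /andP[ay yb]; apply: xeV.
rewrite /ball/= ltr_distlC; apply/andP; split; lra.
Qed.

Lemma open_measurable_plane (A : set (R * R)) : open A -> measurable A.
Proof.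
move=> oA.
have mA := @open_measurable_prod R R A second_countable_real
  second_countable_real oA.
have mid : measurable_fun [set: R] (id : R -> borel R).
  move=> _ B mB; rewrite setTI preimage_id.
  move: B mB; apply: smallest_sub; first exact: sigma_algebra_measurable.
  exact: open_measurable.
have mf : measurable_fun [set: R * R]
    (fun z : R * R => (z.1 : borel R, z.2 : borel R)).
  apply/measurable_fun_pairP; split.
  - exact: (measurableT_comp mid measurable_fst).
  - exact: (measurableT_comp mid measurable_snd).
have := mf measurableT A mA; rewrite setTI.
by congr measurable; apply/seteqP; split=> -[].
Qed.

(** The product sigma-algebra is generated by rectangles with Borel sides, and
    these are intersections of cylinders over sets generated by open
    intervals. *)
Lemma measurable_caratheodory_plane
    (mu : {outer_measure set (R * R) -> \bar R}) :
  (forall G : set (R * R), open G -> mu.-caratheodory G) ->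
  forall A : set (R * R), measurable A -> mu.-caratheodory A.
Proof.
move=> omu.
have mE : @measurable _ R = <<s @RGenOpens.G R >> := RGenOpens.measurableE R.
have cara1 (B : set R) : measurable B -> mu.-caratheodory (B `*` setT).
  rewrite mE; move: B; apply: (@smallest_sub _ _ _ [set B : set R | mu.-caratheodory (B `*` setT)]).
    split => /=.
    - by rewrite set0X; exact: caratheodory_measurable_set0.
    - move=> B mB; rewrite setTD (_ : _ `*` _ = ~` (B `*` setT)).
        exact: caratheodory_measurable_setC.
      by apply/seteqP; split=> -[x y]/=; tauto.
    - move=> F mF; rewrite (_ : _ `*` _ = \bigcup_n (F n `*` setT)).
        exact: caratheodory_measurable_bigcup.
      by apply/seteqP; split=> -[x y]/= => [[[n _ Fn] _]|[n _ [Fn _]]];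
        [exists n|split => //; exists n].
  move=> B /= [a [b ->]]; apply: omu; rewrite setXT.
  by apply: open_comp => [z _|]; [exact: cvg_fst|exact: interval_open].
have cara2 (B : set R) : measurable B -> mu.-caratheodory (setT `*` B).
  rewrite mE; move: B; apply: (@smallest_sub _ _ _ [set B : set R | mu.-caratheodory (setT `*` B)]).
    split => /=.
    - by rewrite setX0; exact: caratheodory_measurable_set0.
    - move=> B mB; rewrite setTD (_ : _ `*` _ = ~` (setT `*` B)).
        exact: caratheodory_measurable_setC.
      by apply/seteqP; split=> -[x y]/=; tauto.
    - move=> F mF; rewrite (_ : _ `*` _ = \bigcup_n (setT `*` F n)).
        exact: caratheodory_measurable_bigcup.
      by apply/seteqP; split=> -[x y]/= => [[_ [n _ Fn]]|[n _ [_ Fn]]];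
        [exists n|split => //; exists n].
  move=> B /= [a [b ->]]; apply: omu; rewrite setTX.
  by apply: open_comp => [z _|]; [exact: cvg_snd|exact: interval_open].
rewrite measurable_prod_measurableType.
apply: smallest_sub.
  split => /=.
  - exact: caratheodory_measurable_set0.
  - by move=> B mB; rewrite setTD; exact: caratheodory_measurable_setC.
  - by move=> F mF; exact: caratheodory_measurable_bigcup.
move=> _ [A mA [B mB <-]].
rewrite (_ : A `*` B = (A `*` setT) `&` (setT `*` B)).
  by apply: caratheodory_measurable_setI; [exact: cara1|exact: cara2].
by apply/seteqP; split=> -[x y]/=; tauto.
Qed.

(** Any cluster point of the image filter is a limit, since an ultrafilter
    contains the preimage of a neighbourhood or that of its complement. *)
Lemma ultra_bounded_cvg (I : Type) (U : set_system I) (u : I -> R) (a b : R) :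
  UltraFilter U -> (forall i, u i \in `[a, b]%R) ->
  exists l : R, u i @[i --> U] --> l.
Proof.
move=> uU uab.
have [|p [_ pU]] := @segment_compact R a b (u i @[i --> U]).
  by rewrite nbhs_filterE/=; apply: filterE => i /=; have := uab i.
exists p => V pV.
have [//|UV] := in_ultra_setVsetC (u @^-1` V) uU.
have [x [Vx]] := pU (~` V) V UV pV.
by [].
Qed.

End plane.

Section ultralimit.
Context {R : realType}.
Local Notation T := (R * R)%type.
Variables (U : set_system nat) (pi : nat -> probability T R).
Hypothesis uU : UltraFilter U.

(** The limit along [U] of the masses of [A]. It exists when [A] is measurable,
    and is then finitely additive in [A], though in general not countably
    additive. *)
Definition ulim (A : set T) : R :=
  xget 0%R [set l : R | fine (pi i A) @[i --> U] --> l].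

Lemma cvg_ulim A : measurable A -> fine (pi i A) @[i --> U] --> ulim A.
Proof.
move=> mA; have [|l lU] := @ultra_bounded_cvg R nat U (fun i => fine (pi i A)) 0 1 uU.
  move=> i; rewrite in_itv/= fine_ge0// -lee_fin fineK ?probability_le1//.
  by rewrite fin_num_measure.
by rewrite /ulim; case: xgetP => //= /(_ l).
Qed.

Lemma ulim_le A B : measurable A -> measurable B -> A `<=` B ->
  (ulim A <= ulim B)%R.
Proof.
move=> mA mB AB; apply: (ler_cvg_to (cvg_ulim mA) (cvg_ulim mB)).
apply: nearW => i; rewrite fine_le ?fin_num_measure// le_measure// inE//.
Qed.

Lemma ulim_le1 A : measurable A -> (ulim A <= 1)%R.
Proof.
move=> mA; have c1 : (fun=> 1%R) i @[i --> U] --> (1%R : R) by exact: cvg_cst.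
apply: (ler_cvg_to (cvg_ulim mA) c1).
apply: nearW => i; rewrite -lee_fin fineK ?probability_le1//.
by rewrite fin_num_measure.
Qed.

Lemma ulimUI A B : measurable A -> measurable B -> A `&` B = set0 ->
  ulim (A `|` B) = (ulim A + ulim B)%R.
Proof.
move=> mA mB AB; apply: (cvg_unique (@Rhausdorff R) (cvg_ulim (measurableU _ _ mA mB))).
rewrite (_ : (fun i => _) = (fun i => fine (pi i A)) \+ (fun i => fine (pi i B)))%R.
  exact: cvgD (cvg_ulim mA) (cvg_ulim mB).
apply/funext => i /=; rewrite measureU// fineD// fin_num_measure//.
Qed.

Lemma ulimU A B : measurable A -> measurable B ->
  (ulim (A `|` B) <= ulim A + ulim B)%R.
Proof.
move=> mA mB.
have -> : A `|` B = A `|` (B `\` A).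
  apply/seteqP; split=> x; last by case=> [|[]]; [left|right].
  by have [Ax|nAx] := pselect (A x); [left|case=> // Bx; right].
rewrite ulimUI//; [|exact: measurableD|exact: setDIK].
by rewrite lerD2l ulim_le//; exact: measurableD.
Qed.

Variable K : set T.
Hypothesis cK : compact K.
Hypothesis piK : forall i, pi i K = 1.

Lemma compact_measurable_plane (C : set T) : compact C -> measurable C.
Proof.
move=> cC; rewrite -(setCK C); apply: measurableC; apply: open_measurable_plane.
apply: closed_openC; apply: compact_closed cC; exact: norm_hausdorff.
Qed.

Let l0 : ulim set0 = 0%R.
Proof.
apply: (cvg_unique (@Rhausdorff R) (cvg_ulim measurable0)).
rewrite (_ : (fun i => _) = fun=> 0%R); first exact: cvg_cst.
by apply/funext => i; rewrite measure0.
Qed.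

Let lU (A B : set T) : compact A -> compact B ->
  (ulim (A `|` B) <= ulim A + ulim B)%R.
Proof. by move=> *; apply: ulimU; exact: compact_measurable_plane. Qed.

Let lUI (A B : set T) : compact A -> compact B -> A `&` B = set0 ->
  ulim (A `|` B) = (ulim A + ulim B)%R.
Proof. by move=> *; apply: ulimUI => //; exact: compact_measurable_plane. Qed.

Let hT : hausdorff_space T. Proof. exact: norm_hausdorff. Qed.
Let nT : normal_space T := @pseudometric_normal R T.

(** Half of the portmanteau theorem, for the measure induced by the content
    [ulim]. The compact set [K] carrying all the measures prevents a loss of mass
    at infinity. *)
Lemma probability_ultralimit : exists P : probability T R,
  forall G, open G -> P G <= (ulim G)%:E.
Proof.
have [|mu [muE cmu]] := compact_content_outer_measure hT nT l0 lU lUI.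
  by exists 1%R => C /compact_measurable_plane; exact: ulim_le1.
have mu0 : (mu : set T -> \bar R) set0 = 0 by [].
have mu_ge0 (A : set T) : 0 <= (mu : set T -> \bar R) A.
  exact: outer_measure_ge0.
have mu_sa : semi_sigma_additive (mu : set T -> \bar R).
  move=> F mF tF mUF; apply: caratheodory_measure_sigma_additive => //.
  - by move=> i; exact: (measurable_caratheodory_plane cmu).
  - exact: (measurable_caratheodory_plane cmu).
pose m := isMeasure.Build _ _ _ (mu : set T -> \bar R) mu0 mu_ge0 mu_sa.
pose P : {measure set T -> \bar R} := HB.pack (mu : set T -> \bar R) m.
have PG G : open G -> P G <= (ulim G)%:E.
  move=> oG; rewrite /P/= muE; apply: le_trans (outer_content_le _ oG _) _ => //.
  apply: ge_ereal_sup => _ [C [cC CG] <-]; rewrite lee_fin.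
  by apply: ulim_le => //; [exact: compact_measurable_plane|exact: open_measurable_plane].
have PT : P setT = 1.
  apply/eqP; rewrite eq_le; apply/andP; split.
    by apply: le_trans (PG _ openT) _; rewrite lee_fin ulim_le1.
  rewrite /P/= muE; apply: le_ereal_inf_tmp => _ [G [oG TG] <-].
  have ulimK : ulim K = 1%R.
    apply: (cvg_unique (@Rhausdorff R) (cvg_ulim (compact_measurable_plane cK))).
    rewrite (_ : (fun i => _) = fun=> 1%R); first exact: cvg_cst.
    by apply/funext => i; rewrite piK.
  by rewrite -[1]/(1%R%:E) -ulimK; apply: inner_content_ge => // x _; exact: TG.
pose mp := Measure_isProbability.Build _ _ _ P PT.
pose Q : probability T R := HB.pack (Measure.sort P) mp.
by exists Q.
Qed.

End ultralimit.

(** * Limits of marginals *)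

Section rays.
Context {R : realType}.
Implicit Types P Q : probability R R.

(** Continuity from below along [`]a + 1/n, +oo[]. *)
Lemma le_ray P Q : (forall a b : R, (a < b)%R -> P `]b, +oo[%classic <= Q `]a, +oo[%classic) ->
  forall a : R, P `]a, +oo[%classic <= Q `]a, +oo[%classic.
Proof.
move=> PQ a.
have Pa : P `](a + k.+1%:R^-1)%R, +oo[%classic @[k --> \oo] --> P `]a, +oo[%classic.
  have -> : `]a, +oo[%classic = \bigcup_k `](a + k.+1%:R^-1)%R, +oo[%classic.
    apply/seteqP; split=> x /=.
      rewrite in_itv/= andbT => ax.
      have [k] := ltr_add_invr ax.
      by exists k => //=; rewrite in_itv/= andbT.
    move=> [k _]/=; rewrite !in_itv/= !andbT; apply: lt_trans.
    by rewrite ltrDl.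
  apply: nondecreasing_cvg_mu => //; first exact: bigcup_measurable.
  move=> m n mn; apply/subsetPset => x/=; rewrite !in_itv/= !andbT.
  by apply: le_lt_trans; rewrite lerD2l lef_pV2 ?posrE// ler_nat.
rewrite -(cvg_lim _ Pa)//; apply: lime_le.
  by apply/cvg_ex; exists (P `]a, +oo[%classic).
by apply: nearW => k; apply: PQ; rewrite ltrDl.
Qed.

Lemma probability_eq_rays P Q :
  (forall a b : R, (a < b)%R -> P `]b, +oo[%classic <= Q `]a, +oo[%classic) ->
  (forall a b : R, (a < b)%R -> Q `]b, +oo[%classic <= P `]a, +oo[%classic) ->
  forall A, measurable A -> P A = Q A.
Proof.
move=> /le_ray PQ /le_ray QP.
apply: (@measure_unique _ _ _ (@RGenOInfty.G R) (fun k => `](- k%:R)%R, +oo[%classic)).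
- exact: RGenOInfty.measurableE.
- move=> _ _ [a ->] [b ->]; exists (Num.max a b).
  by apply/seteqP; split=> x /=; rewrite !in_itv/= !andbT gt_max => /andP.
- by move=> k; exists (- k%:R)%R.
- rewrite -subTset => x _; exists (Num.truncn `|x|%R).+1 => //=.
  rewrite in_itv/= andbT ltrNl; apply: le_lt_trans (truncnS_gt _).
  by rewrite -normrN ler_norm.
- by move=> _ [a ->]; apply/eqP; rewrite eq_le PQ QP.
- by move=> k; rewrite ltey_eq fin_num_measure.
Qed.

End rays.

Section limit_marginal.
Context {R : realType}.
Local Notation T := (R * R)%type.
Variables (U : set_system nat) (pi : nat -> probability T R).
Hypothesis uU : UltraFilter U.
Variable P : probability T R.
Hypothesis PU : forall G : set T, open G -> P G <= (ulim U pi G)%:E.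

Lemma ulim_le_near (G : set T) (x : \bar R) : measurable G -> x \is a fin_num ->
  (\forall k \near U, pi k G <= x) -> (ulim U pi G)%:E <= x.
Proof.
move=> mG; case: x => // x _ ple; rewrite lee_fin.
have cx : (fun=> x) i @[i --> U] --> x by exact: cvg_cst.
apply: (ler_cvg_to (cvg_ulim uU mG) cx).
apply: filterS ple => k pk; rewrite -lee_fin fineK//; exact: fin_num_measure.
Qed.

(** The bound on open sets is one-sided: applied to [f > b] it bounds the law of
    [f] from above, and applied to [f < b] it bounds it from below. The shifts
    from [a] to [b] absorb the atoms of [alpha] as well as marginals that are
    correct only up to a small displacement. *)
Lemma ultralimit_marginal (f : T -> R) (alpha : probability R R) :
  continuous f ->
  (forall a b : R, (a < b)%R ->
    \forall k \near U, pi k (f @^-1` `]b, +oo[%classic) <= alpha `]a, +oo[%classic) ->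
  (forall a b : R, (a < b)%R ->
    \forall k \near U, pi k (f @^-1` `]-oo, a[%classic) <= alpha `]-oo, b]%classic) ->
  forall A, measurable A -> P (f @^-1` A) = alpha A.
Proof.
move=> cf pr pl.
have mf : measurable_fun setT f.
  apply: (measurability _ (RGenOpens.measurableE R)).
  move=> _ [_ [a [b ->] <-]]; rewrite setTI; apply: open_measurable_plane.
  by move/continuousP : cf; apply; exact: interval_open.
have of_ (B : set R) : open B -> open (f @^-1` B) by move/continuousP : cf; exact.
have oR (c : R) : open (f @^-1` `]c, +oo[%classic).
  by apply: of_; exact: interval_open.
have oL (c : R) : open (f @^-1` `]-oo, c[%classic).
  by apply: of_; exact: interval_open.
pose mfi := isMeasurableFun.Build _ _ _ _ f mf.
pose F : {mfun T >-> R} := HB.pack f mfi.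
move=> A mA; rewrite -[LHS]/(distribution P F A); move: A mA.
apply: probability_eq_rays => a b ab /=.
  rewrite /distribution/= /pushforward.
  apply: le_trans (PU (oR _)) _.
  apply: ulim_le_near; [|exact: fin_num_measure|exact: pr].
  exact: open_measurable_plane.
have mp : (a < (a + b) / 2)%R /\ ((a + b) / 2 < b)%R by split; lra.
rewrite -(setCitvl (BRight b)) -(setCitvl (BRight a)).
rewrite !probability_setC//; apply: leeB => //.
rewrite /distribution/= /pushforward.
apply: (@le_trans _ _ (P (f @^-1` `]-oo, ((a + b) / 2)%R[%classic))).
  apply: (@le_measure _ _ _ (distribution P F)); rewrite ?inE//.
  by move=> z; rewrite /= !in_itv/= => /le_lt_trans; apply; case: mp.
apply: le_trans (PU (oL _)) _.
apply: ulim_le_near; [|exact: fin_num_measure|exact: (pl _ _ mp.2)].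
exact: open_measurable_plane.
Qed.

End limit_marginal.

(** * Limits of integrals of lower semicontinuous functions *)

Section layers.
Context {R : realType}.
Local Notation T := (R * R)%type.

(** A staircase approximating [c] from below: [n] steps of height [d], each
    supported on a superlevel set, hence on an open set if [c] is lower
    semicontinuous. *)
Definition layers (c : T -> R) (d : R) (n : nat) (z : T) : R :=
  (\sum_(j < n) d * \1_[set z | j.+1%:R * d < c z] z)%R.

Lemma layers_approx (c : T -> R) (d : R) (n : nat) (z : T) :
  (0 < d)%R -> (0 <= c z <= n%:R * d)%R ->
  (layers c d n z <= c z <= layers c d n z + d)%R.
Proof.
move=> d0 /andP[c0 cn].
have : [/\ (layers c d n z <= c z)%R, (layers c d n z <= n%:R * d)%R &
    (c z <= layers c d n z + d)%R \/ layers c d n z = (n%:R * d)%R].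
  elim: n {cn} => [|n [lc ln IH]].
    by rewrite /layers big_ord0 mul0r; split => //; right.
  rewrite /layers big_ord_recr/= -/(layers c d n z) indicE.
  have nE : (n.+1%:R * d = n%:R * d + d)%R by rewrite -natr1 mulrDl mul1r.
  have [h|h] := ltP (n.+1%:R * d)%R (c z).
    rewrite mem_set// mulr1 nE; move: h; rewrite nE => h.
    by split; [lra|lra|right; case: IH; lra].
  rewrite memNset ?mulr0 ?addr0; last by rewrite /= ltNge h.
  rewrite nE; move: h; rewrite nE => h.
  by split; [lra|lra|left; case: IH; lra].
by move=> [lc ln h]; apply/andP; split => //; case: h => h; lra.
Qed.

Lemma measurable_lsc_plane (c : T -> R) : (forall z, 0 <= c z)%R ->
  (forall t : R, (0 <= t)%R -> open [set z | (t < c z)%R]) ->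
  measurable_fun [set: T] c.
Proof.
move=> c0 lc; apply: (measurability _ (RGenOInfty.measurableE R)).
move=> _ [_ [a ->] <-]; rewrite setTI.
have [a0|a0] := leP 0%R a.
  apply: open_measurable_plane; have := lc _ a0; congr open.
  by apply/seteqP; split=> z /=; rewrite in_itv/= andbT.
rewrite (_ : _ @^-1` _ = setT)// -subTset => z _ /=.
by rewrite in_itv/= andbT (lt_le_trans a0).
Qed.

Lemma integral_layers (P : probability T R) (c : T -> R) (d : R) (n : nat) :
  (0 <= d)%R ->
  (forall t : R, (0 <= t)%R -> open [set z | (t < c z)%R]) ->
  \int[P]_z (layers c d n z)%:E =
  (\sum_(j < n) d * fine (P [set z | j.+1%:R * d < c z]))%R%:E.
Proof.
move=> d0 lc.
have mG (j : nat) : measurable [set z | (j.+1%:R * d < c z)%R].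
  by apply: open_measurable_plane; apply: lc; rewrite mulr_ge0.
under eq_integral do rewrite -sumEFin.
rewrite ge0_integral_sum//=.
- rewrite -sumEFin; apply: eq_bigr => j _.
  under eq_integral do rewrite EFinM.
  rewrite ge0_integralZl_EFin//; last first.
    by apply/measurable_EFinP; exact: measurable_indic.
  rewrite integral_indic// setIT EFinM fineK//.
  exact: fin_num_measure.
- move=> j; apply/measurable_EFinP; apply: measurable_funM => //.
- by move=> j z _; rewrite lee_fin mulr_ge0.
Qed.

Variables (U : set_system nat) (pi : nat -> probability T R).
Hypothesis uU : UltraFilter U.
Variable P : probability T R.
Hypothesis PU : forall G : set T, open G -> P G <= (ulim U pi G)%:E.

(** Fatou's lemma fails along ultrafilters in general, but it holds for the
    staircases, which are finite sums of indicators of open sets, and these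
    approximate [c] uniformly. *)
Lemma ultralimit_integral (c : T -> R) (M V : R) :
  (forall z, 0 <= c z <= M)%R ->
  (forall t : R, (0 <= t)%R -> open [set z | (t < c z)%R]) ->
  (forall e, (0 < e)%R ->
    \forall k \near U, \int[pi k]_z (c z)%:E <= (V + e)%:E) ->
  \int[P]_z (c z)%:E <= V%:E.
Proof.
move=> cM lc pV.
have c0 z : (0 <= c z)%R by have /andP[] := cM z.
have mc := measurable_lsc_plane c0 lc.
have mlayers d n : (0 <= d)%R -> measurable_fun [set: T] (layers c d n).
  move=> d0; apply: measurable_sum => j; apply: measurable_funM => //.
  apply: measurable_indic; apply: open_measurable_plane; apply: lc.
  by rewrite mulr_ge0.
have layers0 d n z : (0 <= d)%R -> (0 <= layers c d n z)%R.
  by move=> d0; apply: sumr_ge0 => j _; rewrite mulr_ge0.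
apply/lee_addgt0Pr => e e0.
(* [d] is spent twice: on the height of a step and on the cost along [U]. *)
pose d := (e / 2)%R; have d0 : (0 < d)%R by rewrite divr_gt0.
pose n := (Num.truncn (M / d)).+1.
have cn z : (0 <= c z <= n%:R * d)%R.
  rewrite c0/=; have /andP[_ /le_trans] := cM z; apply.
  by rewrite -ler_pdivrMr// ltW// truncnS_gt.
pose G (j : nat) := [set z | (j.+1%:R * d < c z)%R].
have oG j : open (G j) by apply: lc; rewrite mulr_ge0// ltW.
have mG j : measurable (G j) by exact: open_measurable_plane.
have Gn : (\sum_(j < n) d * ulim U pi (G j) <= V + d)%R.
  have cG : (\sum_(j < n) d * fine (pi k (G j)))%R @[k --> U] -->
      (\sum_(j < n) d * ulim U pi (G j))%R.
    apply: cvg_big => [|j _]; first exact: add_continuous.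
    apply: cvgMr => //.
    exact: cvg_ulim.
  have cV : (fun=> (V + d)%R) k @[k --> U] --> (V + d)%R by exact: cvg_cst.
  apply: (ler_cvg_to cG cV); apply: filterS (pV d d0) => k pk.
  rewrite -lee_fin -integral_layers//; last exact: ltW.
  apply: le_trans pk; apply: ge0_le_integral => //.
  - by move=> z _; rewrite lee_fin layers0// ltW.
  - by apply/measurable_EFinP; apply: mlayers; exact: ltW.
  - exact/measurable_EFinP.
  - by move=> z _; rewrite lee_fin; have /andP[] := layers_approx d0 (cn z).
apply: (@le_trans _ _ (\int[P]_z ((layers c d n z)%:E + d%:E))).
  apply: ge0_le_integral => //.
  - by move=> z _; rewrite lee_fin.
  - exact/measurable_EFinP.
  - apply: emeasurable_funD => //; apply/measurable_EFinP; apply: mlayers.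
    exact: ltW.
  - by move=> z _; rewrite lee_fin; have /andP[] := layers_approx d0 (cn z).
rewrite ge0_integralD//; last 3 first.
- by move=> z _; rewrite lee_fin layers0// ltW.
- by apply/measurable_EFinP; apply: mlayers; exact: ltW.
- by move=> z _; rewrite lee_fin ltW.
rewrite integral_cst// integral_layers//; last exact: ltW.
rewrite [X in _ * X](_ : _ = 1); last exact: probability_setT.
rewrite mule1 -!EFinD lee_fin.
have -> : (V + e = (V + d) + d)%R by rewrite -addrA -splitr.
rewrite lerD2r; apply: le_trans Gn; apply: ler_sum => j _.
rewrite ler_pM2l// -lee_fin fineK ?fin_num_measure//; last exact: (mG j).
exact: (PU (oG j)).
Qed.

End layers.

(** * The metrics on the half-line *)

Section Lambda_facts.
Context {R : realType}.
Implicit Types (a b r s t : R) (q m : \bar R).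
Local Open Scope ring_scope.

Lemma powRK r a : r != 0 -> 0 <= a -> (a `^ r) `^ r^-1 = a.
Proof. by move=> r0 a0; rewrite -powRrM divff// powRr1. Qed.

Lemma powRVK r a : r != 0 -> 0 <= a -> (a `^ r^-1) `^ r = a.
Proof. by move=> r0 a0; rewrite -powRrM mulVf// powRr1. Qed.

Lemma ler_powR_nneg r a b : 0 <= r -> 0 <= a -> a <= b -> a `^ r <= b `^ r.
Proof.
move=> r0 a0 ab; apply: ge0_ler_powR => //; rewrite nnegrE//.
exact: le_trans ab.
Qed.

Lemma ltr_powR_nneg r a b : 0 < r -> 0 <= a -> a < b -> a `^ r < b `^ r.
Proof.
move=> r0 a0 ab; apply: gt0_ltr_powR => //; rewrite nnegrE//.
exact: le_trans (ltW ab).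
Qed.

Lemma cvg_powR_nneg (I : Type) (F : set_system I) (u : I -> R) (x r : R) :
  Filter F -> 0 < r -> 0 <= x -> (\forall i \near F, 0 <= u i) ->
  u i @[i --> F] --> x -> u i `^ r @[i --> F] --> x `^ r.
Proof.
move=> FF r0 x0 u0 ux; apply/cvgrPdist_lt => e e0.
have rN0 : r != 0 by rewrite gt_eqF.
have up : \forall i \near F, u i < (x `^ r + e) `^ r^-1.
  apply: (cvgr_lt _ ux); rewrite -[ltLHS](powRK rN0 x0).
  by apply: ltr_powR_nneg; rewrite ?invr_gt0 ?powR_ge0 ?ltrDl.
have lo : \forall i \near F, x `^ r - e < u i `^ r.
  have [xe|xe] := ltP (x `^ r - e) 0.
    by apply: nearW => i; rewrite (lt_le_trans xe) ?powR_ge0.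
  have : (x `^ r - e) `^ r^-1 < x.
    rewrite -[ltRHS](powRK rN0 x0).
    by apply: ltr_powR_nneg; rewrite ?invr_gt0// ltrBlDr ltrDl.
  move=> /(cvgr_gt _ ux); apply: filterS => i ui.
  rewrite -[ltLHS](powRVK rN0 xe); apply: ltr_powR_nneg => //.
  exact: powR_ge0.
near=> i; rewrite ltr_distlC; apply/andP; split; first by near: i.
have ui0 : 0 <= u i by near: i.
rewrite -[ltRHS](powRVK rN0); last by rewrite addr_ge0 ?powR_ge0 ?ltW.
by apply: ltr_powR_nneg => //; near: i.
Unshelve. all: by end_near. Qed.

Lemma Lambda_sym q a b : Lambda q a b = Lambda q b a.
Proof. by case: q => [r| |]/=; [rewrite distrC|rewrite eq_sym maxC..]. Qed.

Lemma Lambda_ge0 q a b : 0 <= a -> 0 <= b -> 0 <= Lambda q a b.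
Proof.
move=> a0 b0; case: q => [r| |]/=; first exact: powR_ge0.
  by case: ifPn => // _; rewrite le_max a0.
by case: ifPn => // _; rewrite le_max a0.
Qed.

Lemma Lambda_le_max q a b : (1 <= q)%E -> 0 <= a -> 0 <= b ->
  Lambda q a b <= Num.max a b.
Proof.
move=> + a0 b0; case: q => [r| |]//=; rewrite ?lee_fin => r1.
  have r0 : 0 < r by exact: lt_le_trans r1.
  wlog ab : a b a0 b0 / b <= a => [h|].
    have /orP[ba|ab] := le_total b a; first exact: h.
    by rewrite distrC maxC; exact: h.
  rewrite max_l// -[leRHS](@powRK r) ?gt_eqF//.
  have r0' := ltW r0.
  apply: ler_powR_nneg; rewrite ?invr_ge0//.
  by rewrite ger0_norm ?gerBl ?powR_ge0// subr_ge0 ler_powR_nneg.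
by case: ifPn => // _; rewrite le_max a0.
Qed.

Lemma measurable_Lambda q :
  measurable_fun [set: R * R] (fun z => Lambda q z.1 z.2).
Proof.
case: q => [r| |]/=.
- apply: (measurableT_comp (measurable_powR _)).
  apply: (measurableT_comp (@normr_measurable _ _)) => //.
  by apply: measurable_funB; apply: (measurableT_comp (measurable_powR _)).
- apply: measurable_fun_ifT => //; last exact: measurable_maxr.
  exact: measurable_fun_eqr.
- apply: measurable_fun_ifT => //; last exact: measurable_maxr.
  exact: measurable_fun_eqr.
Qed.

(** Write [x ^ r = x * x ^ (r - 1)] and bound both factors [a ^ (r - 1)] and
    [b ^ (r - 1)] by [(a + b) ^ (r - 1)]. *)
Lemma powR_superadditive r a b : 1 <= r -> 0 <= a -> 0 <= b ->
  a `^ r + b `^ r <= (a + b) `^ r.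
Proof.
move=> r1 a0 b0.
have r0 : 0 < r by exact: lt_le_trans r1.
have [->|aN0] := eqVneq a 0; first by rewrite powR0 ?add0r// gt_eqF.
have [->|bN0] := eqVneq b 0; first by rewrite powR0 ?addr0// gt_eqF.
have ap : 0 < a by rewrite lt0r aN0.
have bp : 0 < b by rewrite lt0r bN0.
have rE : r = 1 + (r - 1) by rewrite addrCA subrr addr0.
have h x : 0 < x -> x `^ r = x * x `^ (r - 1) by move=> x0; rewrite mulr_powRB1// ltW.
rewrite !h ?addr_gt0// mulrDl lerD// ler_wpM2l//.
  by apply: ler_powR_nneg; rewrite ?subr_ge0// lerDl.
by apply: ler_powR_nneg; rewrite ?subr_ge0// lerDr.
Qed.

(** With [u = a ^ m], [v = b ^ m] and [t = q / m >= 1] this is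
    [(u - v) ^ t <= u ^ t - v ^ t], the superadditivity of powers. *)
Lemma le_Lambda q m a b : (1 <= m)%E -> (m <= q)%E -> 0 <= a -> 0 <= b ->
  Lambda m a b <= Lambda q a b.
Proof.
case: m => [m| |]//; last by move=> _; rewrite leye_eq => /eqP ->.
rewrite lee_fin => m1 mq a0 b0.
have m0 : 0 < m by exact: lt_le_trans m1.
have [<-|ab] := eqVneq a b.
  by rewrite {1}/Lambda subrr normr0 powR0 ?invr_eq0 ?gt_eqF// Lambda_ge0.
case: q mq => [q mq|_|//]; last first.
  by rewrite {2}/Lambda (negbTE ab) Lambda_le_max.
rewrite lee_fin in mq.
have q0 : 0 < q by exact: lt_le_trans mq.
wlog : a b a0 b0 {ab} / b <= a => [h|ba].
  have /orP[ba|ba] := le_total b a; first exact: h.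
  by rewrite !(Lambda_sym _ a); exact: h.
have m0' := ltW m0; have q0' := ltW q0.
have bma := ler_powR_nneg m0' b0 ba.
have bqa := ler_powR_nneg q0' b0 ba.
rewrite /Lambda (ger0_norm (_ : 0 <= a `^ m - b `^ m)); last by rewrite subr_ge0.
rewrite (ger0_norm (_ : 0 <= a `^ q - b `^ q)); last by rewrite subr_ge0.
have -> : m^-1 = (q / m) * q^-1 by rewrite mulrAC divff ?mul1r ?gt_eqF.
rewrite powRrM; apply: ler_powR_nneg; rewrite ?invr_ge0 ?powR_ge0//.
have e x : 0 <= x -> x `^ q = (x `^ m) `^ (q / m).
  by rewrite -powRrM mulrCA divff ?mulr1 ?gt_eqF.
rewrite !e// lerBrDr.
have -> : a `^ m = (a `^ m - b `^ m) + b `^ m by rewrite subrK.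
rewrite addrK; apply: powR_superadditive.
- by rewrite ler_pdivlMr ?mul1r.
- by rewrite subr_ge0 ler_powR_nneg.
- exact: powR_ge0.
Qed.

Lemma Lambda_antimono q a b c : (1 <= q)%E -> 0 <= c -> c <= b -> b <= a ->
  Lambda q a b <= Lambda q a c.
Proof.
move=> q1 c0 cb ba.
have b0 := le_trans c0 cb; have a0 := le_trans b0 ba.
case: q q1 => [r r1|_|]; [|rewrite /=|by []].
  rewrite lee_fin in r1; rewrite /=.
  have r0 : 0 < r by exact: lt_le_trans r1.
  have ca := le_trans cb ba.
  have r0' := ltW r0.
  have cbr := ler_powR_nneg r0' c0 cb.
  have bar := ler_powR_nneg r0' b0 ba.
  rewrite !ger0_norm; [|lra..].
  by apply: ler_powR_nneg; rewrite ?invr_ge0//; lra.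
case: ifPn => ab.
  by case: ifPn => // _; rewrite le_max a0.
rewrite ifF; last by apply/negbTE; move: ab; rewrite !neq_lt; lra.
by rewrite !max_l// (le_trans cb).
Qed.

(** [Lambda q] is lower semicontinuous on the half-line. For [q = +oo] it is
    discontinuous on the diagonal, where its value 0 is the smallest possible. *)
Lemma open_Lambda_gt (T : topologicalType) (u v : T -> R) q t :
  (1 <= q)%E -> 0 <= t -> continuous u -> continuous v ->
  (forall z, 0 <= u z) -> (forall z, 0 <= v z) ->
  open [set z | t < Lambda q (u z) (v z)].
Proof.
move=> q1 t0 cu cv u0 v0.
case: q q1 => [r| |]//; rewrite ?lee_fin => r1.
  have r0 : 0 < r by exact: lt_le_trans r1.
  have cL : continuous (fun z => Lambda r%:E (u z) (v z)).
    move=> z; apply: cvg_powR_nneg; rewrite ?invr_gt0//.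
      by apply: nearW => y; exact: normr_ge0.
    apply: cvg_norm; apply: cvgB.
    - by apply: cvg_powR_nneg => //; [exact: nearW|exact: cu].
    - by apply: cvg_powR_nneg => //; [exact: nearW|exact: cv].
  by move/continuousP : cL => /(_ _ (@open_gt R t)).
have -> : [set z | t < Lambda +oo%E (u z) (v z)] =
    [set z | u z - v z != 0] `&` ([set z | t < u z] `|` [set z | t < v z]).
  apply/seteqP; split => z /=; rewrite subr_eq0.
    by case: ifPn => [_|_]; [rewrite ltNge t0|rewrite lt_max => /orP].
  by move=> [/negbTE-> h]; rewrite lt_max; apply/orP.
apply: openI.
  have cuv : continuous (fun z => u z - v z).
    by move=> z; apply: cvgB; [exact: cu|exact: cv].
  by move/continuousP : cuv => /(_ _ (@open_neq R 0)).
apply: openU.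
  by move/continuousP : cu => /(_ _ (@open_gt R t)).
by move/continuousP : cv => /(_ _ (@open_gt R t)).
Qed.

(** The retraction of the line onto [`[0, D]]. *)
Definition clip (D a : R) : R := Num.max 0 (Num.min a D).

Lemma clip_ge0 D a : 0 <= clip D a.
Proof. by rewrite le_max lexx. Qed.

Lemma clip_le D a : 0 <= D -> clip D a <= D.
Proof. by move=> D0; rewrite ge_max D0/= ge_min lexx orbT. Qed.

Lemma clip_id D a : 0 <= a <= D -> clip D a = a.
Proof. by move=> /andP[a0 aD]; rewrite /clip min_l// max_r. Qed.

Lemma continuous_clip D : continuous (clip D).
Proof.
move=> a; apply: (@continuous_max R R^o (cst 0) (idfun \min cst D)).
  exact: cvg_cst.
by apply: (@continuous_min R R^o idfun (cst D)); [exact: cvg_id|exact: cvg_cst].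
Qed.

(** The cost [Lambda q ^ s] on the square [`[0, D] x `[0, D]], extended to the
    whole plane so as to be bounded and lower semicontinuous everywhere. *)
Definition clip_cost q D s (z : R * R) : R :=
  Lambda q (clip D z.1) (clip D z.2) `^ s.

Lemma clip_cost_ge0 q D s z : 0 <= clip_cost q D s z.
Proof. exact: powR_ge0. Qed.

Lemma clip_cost_le q D s z : (1 <= q)%E -> 0 <= D -> 0 <= s ->
  clip_cost q D s z <= D `^ s.
Proof.
move=> q1 D0 s0; apply: ler_powR_nneg => //.
  by apply: Lambda_ge0; exact: clip_ge0.
apply: le_trans (Lambda_le_max q1 (clip_ge0 _ _) (clip_ge0 _ _)) _.
by rewrite ge_max !clip_le.
Qed.

Lemma open_clip_Lambda q D t : (1 <= q)%E -> 0 <= t ->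
  open [set z : R * R | t < Lambda q (clip D z.1) (clip D z.2)].
Proof.
move=> q1 t0; apply: (@open_Lambda_gt _ (clip D \o fst) (clip D \o snd)) => //.
- by move=> z; apply: continuous_comp; [exact: cvg_fst|exact: continuous_clip].
- by move=> z; apply: continuous_comp; [exact: cvg_snd|exact: continuous_clip].
- by move=> z; exact: clip_ge0.
- by move=> z; exact: clip_ge0.
Qed.

Lemma open_clip_cost q D s t : (1 <= q)%E -> 0 < s -> 0 <= t ->
  open [set z : R * R | t < clip_cost q D s z].
Proof.
move=> q1 s0 t0.
rewrite (_ : [set z | _] =
  [set z | t `^ s^-1 < Lambda q (clip D z.1) (clip D z.2)]).
  by apply: open_clip_Lambda => //; exact: powR_ge0.
have sN0 : s != 0 by rewrite gt_eqF.
apply/seteqP; split => z /= h.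
  rewrite -[ltRHS](powRK sN0); last by apply: Lambda_ge0; exact: clip_ge0.
  by apply: ltr_powR_nneg; rewrite ?invr_gt0.
rewrite -[t](powRVK sN0)//; apply: ltr_powR_nneg => //.
exact: powR_ge0.
Qed.

End Lambda_facts.

(** * Supports *)

Lemma second_countable_setX (S T : topologicalType) :
  @second_countable S -> @second_countable T -> @second_countable (S * T)%type.
Proof.
move=> [B cB [oB bB]] [C cC [oC bC]].
exists [set W.1 `*` W.2 | W in B `*` C].
  by apply: sub_countable (card_image_le _ _) _; exact: countableX.
split => [_ [W [BW CW] <-]|[x y] A]/=.
  have -> : W.1 `*` W.2 = (fst @^-1` W.1) `&` (snd @^-1` W.2) by [].
  apply: openI.
    by apply: open_comp => [z _|]; [exact: cvg_fst|exact: oB].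
  by apply: open_comp => [z _|]; [exact: cvg_snd|exact: oC].
move=> [[V W]/= [/bB[V' [BV' V'x] V'V] /bC[W' [CW' W'y] W'W]] VWA].
exists (V' `*` W') => /=; first by split => //; exists (V', W').
by move=> -[a b] [/= /V'V ? /W'W ?]; exact: VWA.
Qed.

Section support.
Context {R : realType}.

Lemma closed_supp (T : topologicalType) (mu : set T -> \bar R) :
  closed (supp mu).
Proof.
rewrite -[X in closed X]setCK; apply: open_closedC.
rewrite openE => x /=; rewrite /supp/= => /existsNP[U /not_implyP[[oU Ux] muU]].
apply: filterS (open_nbhs_nbhs (conj oU Ux)) => y Uy /(_ U (conj oU Uy)).
exact: muU.
Qed.

Lemma supp_subset (T : topologicalType) (mu : set T -> \bar R) (C : set T) :
  closed C -> mu (~` C) = 0 -> supp mu `<=` C.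
Proof.
move=> cC muC x xmu; apply: contrapT => nCx.
have := xmu (~` C) (conj (closed_openC cC) nCx).
by rewrite muC ltxx.
Qed.

Section null.
Context d (M : measurableType d) (T : topologicalType) (f : M -> T).
Variable mu : {measure set M -> \bar R}.
Hypothesis mf : forall A, open A -> measurable (f @^-1` A).
Let nu (A : set T) := mu (f @^-1` A).

(** The complement of the support is the union of the null sets of a countable
    basis. The map [f] transports the open sets of [T] to the sigma-algebra of
    [M]; it allows two structures on the same carrier when it is the identity. *)
Lemma supp_full : @second_countable T -> nu (~` supp nu) = 0.
Proof.
move=> [B cB [oB bB]].
pose F (A : set T) : set T := if `[< B A /\ nu A = 0 >] then A else set0.
have oF A : open (F A).
  by rewrite /F; case: asboolP => [[/oB]|_] //; exact: open0.
have nF A : nu (F A) = 0.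
  by rewrite /F; case: asboolP => [[]|] //; rewrite /nu preimage_set0 measure0.
have -> : ~` supp nu = \bigcup_(A in B) F A.
  apply/seteqP; split => [x|x [A BA]]/=; rewrite /supp/=; last first.
    rewrite /F; case: asboolP => // -[_ nA] Ax /(_ A (conj (oB _ BA) Ax)).
    by rewrite nA ltxx.
  move=> /existsNP[U /not_implyP[[oU Ux] /negP]].
  rewrite -leNgt => muU.
  have [A [BA Ax] AU] := bB x U (open_nbhs_nbhs (conj oU Ux)).
  exists A => //; rewrite /F; case: asboolP => // -[]; split => //.
  apply/eqP; rewrite eq_le measure_ge0 andbT; apply: le_trans muU.
  apply: le_measure; rewrite ?inE; [exact/mf/oB|exact: mf|].
  exact: preimage_subset.
have /pfcard_geP[->|[g]] : countable B by [].
  by rewrite bigcup_set0 /nu preimage_set0 measure0.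
rewrite -(image_eq g) bigcup_image /nu preimage_bigcup.
have : mu.-negligible (\bigcup_n f @^-1` F (g n)).
  apply: negligible_bigcup => n.
  by exists (f @^-1` F (g n)); split => //; [exact: mf|exact: nF].
move=> /measure_negligible; apply.
by apply: bigcupT_measurable => n; exact: mf.
Qed.

End null.

(** The image of a compact support is closed, and its complement is an open set
    without mass. *)
Lemma supp_pushforward_sub (T1 T2 : topologicalType) (phi : T1 -> T2)
    (mu1 : set T1 -> \bar R) (mu2 : set T2 -> \bar R) :
  hausdorff_space T2 -> continuous phi -> compact (supp mu1) ->
  mu1 (~` supp mu1) = 0 ->
  (forall A B, open A -> open B -> A `<=` B -> mu1 A <= mu1 B) ->
  (forall A, open A -> mu2 A = mu1 (phi @^-1` A)) ->
  supp mu2 `<=` phi @` supp mu1.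
Proof.
move=> hT cphi cS S0 mu1S mu2E x xmu; apply: contrapT => nx.
have oI : open (~` (phi @` supp mu1)).
  apply: closed_openC; apply: compact_closed => //.
  by apply: continuous_compact => //; exact: continuous_subspaceT.
have := xmu _ (conj oI nx); rewrite mu2E// ltNge => /negP; apply.
rewrite -S0; apply: mu1S.
- by move/continuousP : cphi; exact.
- exact/closed_openC/closed_supp.
- by move=> z /= nz Sz; apply: nz; exists z.
Qed.

Lemma supp_neq0 d (T : measurableType d) (P : probability T R) (S : set T) :
  P (~` S) = 0 -> S !=set0.
Proof.
move=> PS; apply/set0P/eqP => S0; move: PS.
by rewrite S0 setC0 probability_setT => /eqP; rewrite onee_eq0.
Qed.

End support.

(** * Couplings of measures on the half-line *)

Section integral_facts.
Context d (T : measurableType d) (R : realType) (mu : {measure set T -> \bar R}).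

(** The integral of a nonnegative function is a supremum over simple functions
    below it, whence monotonicity without measurability. This is what gives
    access to the integral of the Wasserstein distance of local distributions,
    whose measurability is not established. *)
Lemma ge0_le_lower_integral (f g : T -> \bar R) :
  (forall x, 0 <= f x) -> (forall x, f x <= g x) ->
  \int[mu]_x f x <= \int[mu]_x g x.
Proof.
move=> f0 fg; rewrite !ge0_integralTE//; last by move=> x; exact: le_trans (fg x).
apply: ereal_sup_le => _ [h hf <-].
by exists h => // x; exact: le_trans (fg x).
Qed.

End integral_facts.

Lemma product_coupling d1 d2 (T1 : measurableType d1) (T2 : measurableType d2)
    (R : realType) (alpha : probability T1 R) (beta : probability T2 R) :
  coupling alpha beta (alpha \x beta)%E.
Proof.
split => A mA; rewrite /pushforward.
  rewrite -setXT [LHS](product_measure1E alpha beta mA measurableT).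
  by rewrite [X in _ * X](probability_setT beta) mule1.
by rewrite -setTX [LHS](product_measure1E alpha beta measurableT mA)
  [X in X * _](probability_setT alpha) mul1e.
Qed.

Section couplings.
Context {R : realType}.
Implicit Types (alpha beta : probability R R).

Definition square (D : R) : set (R * R) := `[0%R, D] `*` `[0%R, D].

Lemma compact_square D : compact (square D).
Proof. by apply: compact_setX; exact: segment_compact. Qed.

Lemma measurable_square D : measurable (square D).
Proof. by apply: measurableX; exact: measurable_itv. Qed.

Lemma square_quadrant D : square D `<=` quadrant.
Proof.
move=> [a b] []; rewrite /= !in_itv/= => /andP[a0 _] /andP[b0 _].
by split; rewrite /= in_itv/= andbT.
Qed.

Lemma measurable_quadrant : measurable (@quadrant R).
Proof. by apply: measurableX; exact: measurable_itv. Qed.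

Lemma coupling_square alpha beta (gamma : probability (R * R)%type R) (D : R) :
  coupling alpha beta gamma -> alpha `[0%R, D]%classic = 1 ->
  beta `[0%R, D]%classic = 1 -> gamma (square D) = 1.
Proof.
move=> [ga gb] aD bD.
have mI : measurable (`[0%R, D]%classic : set R) by exact: measurable_itv.
have mf1 : measurable (fst @^-1` `[0%R, D]%classic : set (R * R)).
  by rewrite -[X in measurable X]setTI; exact: measurable_fst.
have mf2 : measurable (snd @^-1` `[0%R, D]%classic : set (R * R)).
  by rewrite -[X in measurable X]setTI; exact: measurable_snd.
have ga1 : gamma (~` (fst @^-1` `[0%R, D]%classic)) = 0.
  by rewrite probability_setC// -[gamma _]/(pushforward gamma fst _) ga// aD subee.
have gb1 : gamma (~` (snd @^-1` `[0%R, D]%classic)) = 0.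
  by rewrite probability_setC// -[gamma _]/(pushforward gamma snd _) gb// bD subee.
rewrite -(setCK (square D)) probability_setC; last first.
  by apply: measurableC; exact: measurable_square.
rewrite (_ : ~` _ = ~` (fst @^-1` `[0%R, D]%classic) `|`
    ~` (snd @^-1` `[0%R, D]%classic)).
  by rewrite [X in _ - X]null_set_setU ?sube0//; exact: measurableC.
by rewrite -setCI.
Qed.

Lemma integral_clip_cost (gamma : probability (R * R)%type R) q D s :
  gamma (square D) = 1 ->
  \int[gamma]_(z in quadrant) (Lambda q z.1 z.2 `^ s)%:E =
  \int[gamma]_z (clip_cost q D s z)%:E.
Proof.
move=> gD; rewrite integral_mkcond.
have mS := measurable_square D.
have gDC : gamma (~` square D) = 0.
  by rewrite probability_setC// gD subee.
apply: ae_eq_integral => //.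
- apply/(measurable_restrictT _ measurable_quadrant).
  apply/measurable_EFinP; apply: measurable_funTS.
  exact: (measurableT_comp (measurable_powR _) (measurable_Lambda q)).
- apply/measurable_EFinP; apply: (measurableT_comp (measurable_powR _)).
  have mc : measurable_fun [set: R] (clip D).
    by apply: measurable_maxr => //; apply: measurable_minr.
  have mcc : measurable_fun [set: R * R] (fun z => (clip D z.1, clip D z.2)).
    by apply/measurable_fun_pairP; split;
      [exact: (measurableT_comp mc)|exact: (measurableT_comp mc)].
  exact: (measurableT_comp (measurable_Lambda q) mcc).
- exists (~` square D); split => //; first exact: measurableC.
  apply: subsetC => z Sz _ /=.
  rewrite patchE mem_set; last exact: square_quadrant Sz.
  by rewrite /clip_cost; case: Sz; rewrite /= !in_itv/= => /clip_id-> /clip_id->.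
Qed.

Lemma supp_plane_full (pi : probability (R * R)%type R) :
  pi (~` supp (pi : set (R * R) -> \bar R)) = 0.
Proof.
apply: (@supp_full R _ _ (R * R)%type (fun z : R * R => z)).
  by move=> A oA; exact: open_measurable_plane.
by apply: second_countable_setX; exact: second_countable_real.
Qed.

Lemma supp_square (pi : probability (R * R)%type R) (D : R) :
  pi (square D) = 1 -> supp (pi : set (R * R) -> \bar R) `<=` square D.
Proof.
move=> piD; apply: supp_subset.
  by apply: compact_closed (@compact_square D); exact: norm_hausdorff.
by rewrite probability_setC ?piD ?subee//; exact: measurable_square.
Qed.

End couplings.

(** * Metric measure spaces *)

Section mmspaces.
Context {R : realType}.
Implicit Types X Y : mmspace R.

Lemma mm_second_countable X : @second_countable X.
Proof. exact/(@compact_second_countable R)/mm_compact. Qed.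

Lemma mdist_max X : exists x0 x1 : X, forall x x' : X,
  (mdist x x' <= mdist x0 x1)%R.
Proof.
have [|||[x0 x1] _ h] := @compact_EVT_max (X * X)%type R
    (fun z => mdist z.1 z.2) setT.
- by exists (point, point).
- by rewrite -setXTT; apply: compact_setX; exact: mm_compact.
- by apply: continuous_subspaceT; exact: continuous_mdist.
- by exists x0, x1 => x x'; have := h (x, x'); rewrite inE; apply.
Qed.

Lemma mdist_bounded X Y : exists D : R, [/\ (0 <= D)%R,
  forall x x' : X, (mdist x x' <= D)%R & forall y y' : Y, (mdist y y' <= D)%R].
Proof.
have [x0 [x1 hx]] := mdist_max X; have [y0 [y1 hy]] := mdist_max Y.
exists (Num.max (mdist x0 x1) (mdist y0 y1)); split.
- by rewrite le_max mdist_ge0.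
- by move=> x x'; rewrite le_max hx.
- by move=> y y'; rewrite le_max hy orbT.
Qed.

Lemma dh_itv X (x : X) (D : R) : (forall x x' : X, (mdist x x' <= D)%R) ->
  dh x `[0%R, D]%classic = 1.
Proof.
move=> hD; rewrite /dh/= /distribution /pushforward.
rewrite (_ : _ @^-1` _ = setT) ?probability_setT// -subTset => x' _.
by rewrite /= in_itv/= mdist_ge0 hD.
Qed.

Lemma dH_itv X (D : R) : (forall x x' : X, (mdist x x' <= D)%R) ->
  dH X `[0%R, D]%classic = 1.
Proof.
move=> hD; rewrite /dH/= /distribution /pushforward.
rewrite (_ : _ @^-1` _ = setT) ?probability_setT// -subTset => x' _.
by rewrite /= in_itv/= mdist_ge0 hD.
Qed.

Lemma measurable_dh X (A : set R) : measurable A ->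
  measurable_fun [set: borel X] (fun x : borel X => dh (x : X) A).
Proof.
move=> mA.
have := @measurable_fun_xsection _ _ (borel X) (borel X) R (mm_measure X)
  (@dist_pair R X @^-1` A).
have : measurable (@dist_pair R X @^-1` A) by exact: measurable_funPTI.
move=> mB /(_ mB); apply: eq_measurable_fun => x _ /=.
congr (mm_measure X _); apply/seteqP; split => y; rewrite /xsection/= inE//.
Qed.

Lemma dHE X (A : set R) : measurable A ->
  dH X A = \int[mm_measure X]_x dh (x : X) A.
Proof.
move=> mA; rewrite /dH/= /distribution /pushforward /product_measure1.
apply: eq_integral => x _ /=.
by congr (mm_measure X _); apply/seteqP; split => y; rewrite /xsection/= inE.
Qed.

Lemma integral_coupling_fst X Y (gamma : probability (borel X * borel Y)%type R)
    (f : borel X -> \bar R) :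
  coupling (mm_measure X) (mm_measure Y) gamma ->
  measurable_fun setT f -> (forall x, 0 <= f x) ->
  \int[gamma]_z f z.1 = \int[mm_measure X]_x f x.
Proof.
move=> [g1 _] mf f0.
rewrite -[LHS](@ge0_integral_pushforward _ _ _ _ _ fst measurable_fst gamma setT)//.
by apply: eq_measure_integral => A mA _; exact: g1.
Qed.

Lemma integral_coupling_snd X Y (gamma : probability (borel X * borel Y)%type R)
    (f : borel Y -> \bar R) :
  coupling (mm_measure X) (mm_measure Y) gamma ->
  measurable_fun setT f -> (forall x, 0 <= f x) ->
  \int[gamma]_z f z.2 = \int[mm_measure Y]_x f x.
Proof.
move=> [_ g2] mf f0.
rewrite -[LHS](@ge0_integral_pushforward _ _ _ _ _ snd measurable_snd gamma setT)//.
by apply: eq_measure_integral => A mA _; exact: g2.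
Qed.

Lemma supp_coupling X Y (gamma : probability (borel X * borel Y)%type R) :
  let S := supp (gamma : set (X * Y) -> \bar R) in
  compact S /\ gamma (~` S) = 0.
Proof.
split.
  apply: (@subclosed_compact _ _ setT) => //; first exact: closed_supp.
  by rewrite -setXTT; apply: compact_setX; exact: mm_compact.
apply: (@supp_full R _ _ (X * Y)%type (fun z : borel X * borel Y => (z : X * Y))).
  by move=> A oA; apply: open_measurable_prod => //; exact: mm_second_countable.
by apply: second_countable_setX; exact: mm_second_countable.
Qed.

End mmspaces.

(** * The distortion bounds the third lower bound *)

Section first_inequality.
Context {R : realType}.
Implicit Types (X Y : mmspace R) (p q : \bar R).

Lemma poweRVK (x : \bar R) (r : R) : (0 < r)%R -> 0 <= x ->
  (x `^ r^-1) `^ r = x.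
Proof. by move=> r0 x0; rewrite -poweRrM mulVf ?gt_eqF// poweRe1. Qed.

Lemma le_poweR (x y : \bar R) (r : R) : (0 <= r)%R -> 0 <= x -> x <= y ->
  x `^ r <= y `^ r.
Proof.
move=> r0 x0 xy; apply: gt0_ler_poweR => //; rewrite in_itv/= leey andbT//.
exact: le_trans xy.
Qed.

Definition dists_from X Y (z : X * Y) : borel X * borel Y -> R * R :=
  fun z' => (mdist z.1 (z'.1 : X), mdist z.2 (z'.2 : Y)).

Lemma measurable_dists_from X Y (z : X * Y) :
  measurable_fun setT (dists_from z).
Proof.
apply/measurable_fun_pairP; split.
- exact: (measurableT_comp (measurable_mdistr z.1) measurable_fst).
- exact: (measurableT_comp (measurable_mdistr z.2) measurable_snd).
Qed.

HB.instance Definition _ X Y (z : X * Y) :=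
  isMeasurableFun.Build _ _ _ _ (dists_from z) (measurable_dists_from z).

Lemma continuous_dists_from X Y (z : X * Y) :
  continuous (dists_from z : X * Y -> R * R).
Proof.
have c (T : metricType R) (x : T) : continuous (fun y : T => mdist x y).
  move=> y.
  have xy : (x, t) @[t --> y] --> ((x, y) : T * T).
    exact: (cvg_pair (cvg_cst x) cvg_id).
  exact: (cvg_comp _ _ xy (@continuous_mdist R T (x, y))).
have c1 : continuous (fun z' : X * Y => mdist z.1 z'.1).
  by move=> z'; apply: continuous_comp; [exact: cvg_fst|exact: c].
have c2 : continuous (fun z' : X * Y => mdist z.2 z'.2).
  by move=> z'; apply: continuous_comp; [exact: cvg_snd|exact: c].
by move=> z'; exact: (cvg_pair (c1 z') (c2 z')).
Qed.

Section dists.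
Context X Y (gamma : probability (borel X * borel Y)%type R).
Hypothesis cg : coupling (mm_measure X) (mm_measure Y) gamma.

(** The marginals of the pushforward are pushforwards of the marginals. *)
Lemma coupling_dists_from (z : X * Y) :
  coupling (dh z.1) (dh z.2) (distribution gamma (dists_from z)).
Proof.
have [g1 g2] := cg; split => A mA.
- exact: (g1 _ (measurable_funPTI (dist_from z.1) mA)).
- exact: (g2 _ (measurable_funPTI (dist_from z.2) mA)).
Qed.

Lemma dists_from_quadrant (z : X * Y) z' : quadrant (dists_from z z').
Proof. by split; rewrite /= in_itv/= mdist_ge0. Qed.

Lemma wasserstein_dh_le (r : R) q (z : X * Y) : (0 < r)%R ->
  (wasserstein r%:E q (dh z.1) (dh z.2)) `^ r <=
  \int[gamma]_z' ((Lambda q (mdist z.1 (z'.1 : X)) (mdist z.2 (z'.2 : Y))) `^ r)%:E.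
Proof.
move=> r0; set I := (leRHS).
have I0 : 0 <= I by apply: integral_ge0 => z' _; rewrite lee_fin powR_ge0.
rewrite -[leRHS](poweRVK r0 I0); apply: le_poweR; first exact: ltW.
  by apply: le_ereal_inf_tmp => _ [pi _ <-]; exact: poweR_ge0.
apply: ereal_inf_lbound; exists (distribution gamma (dists_from z)).
  exact: coupling_dists_from.
congr (_ `^ _); rewrite ge0_integral_pushforward//=.
- rewrite (_ : _ @^-1` _ = setT)//.
  by rewrite -subTset => z' _; exact: dists_from_quadrant.
- exact: measurable_quadrant.
- apply/measurable_EFinP; apply: measurable_funTS.
  exact: (measurableT_comp (measurable_powR _) (measurable_Lambda q)).
- by move=> y _; rewrite lee_fin powR_ge0.
Qed.

Lemma wassersteiny_dh_le q (z : X * Y) :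
  wasserstein +oo q (dh z.1) (dh z.2) <=
  ereal_sup [set (Lambda q (mdist z.1 z'.1) (mdist z.2 z'.2))%:E
            | z' in supp (gamma : set (X * Y) -> \bar R)].
Proof.
have [cS S0] := supp_coupling gamma.
apply: ge_ereal_inf; eexists.
  by exists (distribution gamma (dists_from z)) => //; exact: coupling_dists_from.
apply: ge_ereal_sup => _ [ab [sab _] <-].
have : (dists_from z @` supp (gamma : set (X * Y) -> \bar R)) ab.
  apply: (@supp_pushforward_sub R (X * Y)%type (R * R)%type (dists_from z) gamma
    (distribution gamma (dists_from z)) _ _ cS S0 _ _ _ sab) => //.
  - exact: continuous_dists_from.
  - move=> A B oA oB AB; apply: le_measure => //; rewrite inE;
      by apply: open_measurable_prod => //; exact: mm_second_countable.
move=> [z' Sz' <-]; apply: ereal_sup_ubound; exists z' => //.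
Qed.

Lemma TLB_le_distortion p q : 1 <= p -> TLB p q X Y <= distortion p q gamma.
Proof.
case: p => [r| |]//=; rewrite ?lee_fin => r1.
  have r0 : (0 < r)%R by exact: lt_le_trans r1.
  apply: ge_ereal_inf; eexists; first by exists gamma.
  apply: le_poweR; first by rewrite invr_ge0 ltW.
    by apply: integral_ge0 => z _; exact: poweR_ge0.
  apply: ge0_le_lower_integral => z; first exact: poweR_ge0.
  exact: wasserstein_dh_le.
apply: ge_ereal_inf; eexists; first by exists gamma.
apply: ge_ereal_sup => _ [z Sz <-].
apply: le_trans (wassersteiny_dh_le q z) _.
apply: ge_ereal_sup => _ [z' Sz' <-]; apply: ereal_sup_ubound.
by exists (z, z').
Qed.

End dists.

Lemma TLB_le_dGW p q X Y : 1 <= p -> TLB p q X Y <= 2%:E * dGW p q X Y.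
Proof.
move=> p1; rewrite /dGW muleA -EFinM divff// mul1e.
by apply: le_ereal_inf_tmp => _ [gamma cg <-]; exact: TLB_le_distortion.
Qed.

End first_inequality.

(** * Measurable mixtures and small cells *)

Lemma measurable_fun_nat_fibers d (T : measurableType d) (v : T -> nat) :
  (forall n, measurable (v @^-1` [set n])) -> measurable_fun setT v.
Proof.
move=> mv _ A _; rewrite setTI.
rewrite (_ : v @^-1` A = \bigcup_(n in A) v @^-1` [set n]).
  by apply: bigcup_measurable => n _; exact: mv.
by apply/seteqP; split=> z /=; [move=> Az; exists (v z)|move=> [n An ->]].
Qed.

(** As [v] takes countably many values, [z |-> pi (v z)] is a kernel whatever the
    family [pi] is; the mixture is its composition with [gamma]. *)
Lemma probability_mixture d1 d2 (T1 : measurableType d1) (T2 : measurableType d2)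
    (R : realType) (gamma : probability T1 R) (v : T1 -> nat)
    (pi : nat -> probability T2 R) :
  measurable_fun setT v ->
  exists m : probability T2 R,
    (forall A, measurable A -> m A = \int[gamma]_z pi (v z) A) /\
    (forall h : T2 -> \bar R, measurable_fun setT h -> (forall y, 0 <= h y) ->
      \int[m]_y h y = \int[gamma]_z \int[pi (v z)]_y h y).
Proof.
move=> mv.
pose f (z : T1) : giry T2 R := pi (v z).
have mf : measurable_fun [set: T1] f.
  have mpi : measurable_fun [set: nat] (fun n => pi n : giry T2 R) by [].
  exact: (measurableT_comp mpi mv).
pose m := giry_bind gamma mf.
have mh (h : T2 -> \bar R) : measurable_fun setT h -> (forall y, 0 <= h y) ->
    \int[m]_y h y = \int[gamma]_z \int[pi (v z)]_y h y.
  move=> mh h0; exact: (giry_int_bind gamma mf mh h0).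
have mA A : measurable A -> m A = \int[gamma]_z pi (v z) A.
  move=> mA; have := mh (fun y => (\1_A y)%:E).
  rewrite integral_indic// setIT => ->; last 2 first.
  - by apply/measurable_EFinP; exact: measurable_indic.
  - by move=> y; rewrite lee_fin.
  by apply: eq_integral => z _; rewrite integral_indic// setIT.
have mT : m setT = 1.
  rewrite mA//.
  under eq_integral do rewrite probability_setT.
  by rewrite integral_cst// mul1e; exact: probability_setT.
pose mp := Measure_isProbability.Build _ _ _ m mT.
pose Q : probability T2 R := HB.pack (SubProbability.sort m) mp.
by exists Q.
Qed.

Section cells.
Context {R : realType}.
Implicit Types X Y : mmspace R.

(** The fibers of [v] are the sets of a countable cover by small open sets, made
    disjoint. *)
Lemma small_cells X Y (e : R) : (0 < e)%R ->
  exists v : borel X * borel Y -> nat, measurable_fun setT v /\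
    forall z z', v z = v z' ->
      (mdist (z.1 : X) z'.1 < e)%R /\ (mdist (z.2 : Y) z'.2 < e)%R.
Proof.
move=> e0.
have [B cB [oB bB]] := second_countable_setX (mm_second_countable X)
  (mm_second_countable Y).
pose good (A : set (X * Y)) := B A /\ forall z z', A z -> A z' ->
  (mdist z.1 z'.1 < e)%R /\ (mdist z.2 z'.2 < e)%R.
have cover z : exists2 A, good A & A z.
  have e20 : (0 < e / 2)%R by rewrite divr_gt0.
  pose V := ball z.1 (e / 2) `*` ball z.2 (e / 2).
  have : nbhs z V.
    exists (ball z.1 (e / 2), ball z.2 (e / 2)) => //.
    by split; exact: nbhsx_ballx.
  move=> /bB[A [BA Az] AV]; exists A => //; split => // a b /AV + /AV.
  rewrite /V/= !ballEmdist => -[/= a1 a2] [/= b1 b2].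
  have t1 := metric_triangle a.1 z.1 b.1.
  have t2 := metric_triangle a.2 z.2 b.2.
  rewrite (metric_sym a.1 z.1) in t1; rewrite (metric_sym a.2 z.2) in t2.
  by split; lra.
have cgood : countable good by apply: sub_countable cB; apply: subset_card_le => A [].
have /pfcard_geP[g0|[g]] := cgood.
  have [A] := cover point; by rewrite g0.
pose F n : set (X * Y) := g n.
have gF n : good (F n) by rewrite -(image_eq g); exists n.
have mF n : measurable (F n : set (borel X * borel Y)).
  by apply: open_measurable_prod; [exact: mm_second_countable..|apply: oB; case: (gF n)].
have mD n : measurable (seqDU F n : set (borel X * borel Y)).
  apply: measurableD => //.
  by rewrite -bigcup_mkord; exact: bigcup_measurable.
have coverD z : exists n, seqDU F n z.
  have [A gA Az] := cover z.
  have [n _ gn] : (g @` setT) A by rewrite image_eq.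
  have : (\bigcup_n F n) z by exists n => //; rewrite /F gn.
  by rewrite seqDU_bigcup_eq => -[m _]; exists m.
pose v z := xget 0%N [set n | seqDU F n z].
have vP z : seqDU F (v z) z.
  by rewrite /v; case: xgetP => //= /(_ _); have [n h] := coverD z => /(_ n).
exists v; split.
  apply: measurable_fun_nat_fibers => n.
  rewrite (_ : _ @^-1` _ = seqDU F n)//.
  apply/seteqP; split => z /= => [<-|Fz]; first exact: vP.
  by apply: (@trivIset_seqDU _ F (v z) n I I); exists z.
move=> z z' vz; have [_] := gF (v z); apply.
  by have [] := vP z.
by rewrite vz; have [] := vP z'.
Qed.

End cells.

(** * Gluing couplings of local distance distributions *)

Section gluing.
Context {R : realType}.
Implicit Types X Y : mmspace R.

Lemma dh_rray_le X (x x' : X) (e a b : R) : (mdist x x' < e)%R ->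
  (a + e <= b)%R -> dh x' `]b, +oo[%classic <= dh x `]a, +oo[%classic.
Proof.
move=> xx' ab; apply: (@le_measure _ _ _ (mm_measure X)); rewrite ?inE.
- exact: (measurable_funPTI (dist_from x')).
- exact: (measurable_funPTI (dist_from x)).
move=> y; rewrite /= !in_itv/= !andbT /dist_from => by_.
have := metric_triangle x' x y; rewrite (metric_sym x' x); lra.
Qed.

Lemma dh_lray_le X (x x' : X) (e a b : R) : (mdist x x' < e)%R ->
  (a + e <= b)%R -> dh x' `]-oo, a[%classic <= dh x `]-oo, b]%classic.
Proof.
move=> xx' ab; apply: (@le_measure _ _ _ (mm_measure X)); rewrite ?inE.
- exact: (measurable_funPTI (dist_from x')).
- exact: (measurable_funPTI (dist_from x)).
move=> y; rewrite /= !in_itv/= /dist_from => ya.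
have := metric_triangle x x' y; lra.
Qed.

(** The optimal value of Kantorovich's problem for the cost [c]. *)
Definition transport_cost (c : R * R -> R) (alpha beta : probability R R) : \bar R :=
  ereal_inf [set \int[pi]_z (c z)%:E | pi in coupling alpha beta].

Lemma transport_cost_ge0 (c : R * R -> R) (alpha beta : probability R R) :
  (forall z, 0 <= c z)%R -> 0 <= transport_cost c alpha beta.
Proof.
move=> c0; apply: le_ereal_inf_tmp => _ [pi _ <-].
by apply: integral_ge0 => z _; rewrite lee_fin.
Qed.

Section fixed_cost.
Variables (c : R * R -> R) (M : R).
Hypothesis cM : forall z, (0 <= c z <= M)%R.
Hypothesis mc : measurable_fun [set: R * R] c.

Let c0 z : (0 <= c z)%R. Proof. by have /andP[] := cM z. Qed.

(** The product measure is a coupling, of cost at most [M]. *)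
Lemma transport_cost_fin_num alpha beta :
  transport_cost c alpha beta \is a fin_num.
Proof.
rewrite ge0_fin_numE ?transport_cost_ge0//.
apply: (@le_lt_trans _ _ M%:E); last exact: ltry.
apply: ge_ereal_inf; eexists.
  by exists (alpha \x beta)%E => //; exact: product_coupling.
apply: (@le_trans _ _ (\int[alpha \x beta]_z (cst M%:E) z)).
  apply: ge0_le_lower_integral => z; first by rewrite lee_fin.
  by rewrite lee_fin; have /andP[] := cM z.
rewrite integral_cst//.
by rewrite [X in _ * X](_ : _ = 1) ?mule1//; exact: probability_setT.
Qed.

(** A single coupling serves a whole cell: it belongs to a point [w] where the
    transport cost is within e / 2 of its infimum over the cell, and it is
    optimal up to e / 2 at [w]. Replacing a point by the representative of its
    cell moves all distances by less than e, which is the displacement of the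
    rays in the conclusion. *)
Lemma approx_glued_coupling X Y (gamma : probability (borel X * borel Y)%type R)
    (D V e : R) :
  coupling (mm_measure X) (mm_measure Y) gamma ->
  (forall x x' : X, (mdist x x' <= D)%R) ->
  (forall y y' : Y, (mdist y y' <= D)%R) ->
  \int[gamma]_z transport_cost c (dh (z.1 : X)) (dh (z.2 : Y)) <= V%:E ->
  (0 < e)%R ->
  exists m : probability (R * R)%type R,
    [/\ m (square D) = 1, \int[m]_z (c z)%:E <= (V + e)%:E,
    (forall a b : R, (a + e <= b)%R ->
      m (fst @^-1` `]b, +oo[%classic) <= dH X `]a, +oo[%classic /\
      m (fst @^-1` `]-oo, a[%classic) <= dH X `]-oo, b]%classic) &
    (forall a b : R, (a + e <= b)%R ->
      m (snd @^-1` `]b, +oo[%classic) <= dH Y `]a, +oo[%classic /\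
      m (snd @^-1` `]-oo, a[%classic) <= dH Y `]-oo, b]%classic)].
Proof.
move=> cg hX hY hV e0.
have [v [mv hv]] := small_cells X Y e0.
pose W (z : X * Y) := transport_cost c (dh z.1) (dh z.2).
have /choice[f hf] n : exists pw : probability (R * R)%type R * (X * Y),
    (exists z, v z = n) -> [/\ v pw.2 = n, coupling (dh pw.2.1) (dh pw.2.2) pw.1 &
      forall z, v z = n -> \int[pw.1]_y (c y)%:E <= W z + e%:E].
  have [[z0 vz0]|nz] := pselect (exists z, v z = n); last first.
    exists ((dh (point : X) \x dh (point : Y))%E : probability (R * R)%type R, point).
    by case=> z vz; case: nz; exists z.
  pose I := ereal_inf [set W z | z in v @^-1` [set n]].
  have I0 : 0 <= I.
    by apply: le_ereal_inf_tmp => _ [z _ <-]; exact: transport_cost_ge0.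
  have If : I \is a fin_num.
    rewrite ge0_fin_numE//; apply: (@le_lt_trans _ _ (W z0)).
      by apply: ereal_inf_lbound; exists z0.
    by rewrite -ge0_fin_numE ?transport_cost_ge0// transport_cost_fin_num.
  have e20 : (0 < e / 2)%R by rewrite divr_gt0.
  have [_ [w vw <-] wI] := lb_ereal_inf_adherent e20 If.
  have [_ [pi cpi <-] piw] := lb_ereal_inf_adherent e20
    (transport_cost_fin_num (dh w.1) (dh w.2)).
  exists (pi, w) => _ /=; split => // z vz.
  apply: (le_trans (ltW piw)).
  have -> : e%:E = (e / 2)%:E + (e / 2)%:E by rewrite -EFinD -splitr.
  rewrite addeA; apply: leeD => //; apply: (le_trans (ltW wI)).
  by apply: leeD => //; apply: ereal_inf_lbound; exists z.
have hfv z := hf (v z) (ex_intro _ z erefl).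
have [m [mE mI]] := probability_mixture gamma (fun n => (f n).1) mv.
have near1 z : (mdist z.1 (f (v z)).2.1 < e)%R.
  by have [vw _ _] := hfv z; have [] := hv z (f (v z)).2 (esym vw).
have near2 z : (mdist z.2 (f (v z)).2.2 < e)%R.
  by have [vw _ _] := hfv z; have [] := hv z (f (v z)).2 (esym vw).
have m1 A B : measurable A -> measurable B ->
    (forall z, dh (f (v z)).2.1 B <= dh z.1 A) -> m (fst @^-1` B) <= dH X A.
  move=> mA mB BA.
  rewrite mE; last by rewrite -[X in measurable X]setTI; exact: measurable_fst.
  rewrite dHE// -(integral_coupling_fst cg (@measurable_dh R X _ mA))//.
  apply: ge0_le_lower_integral => z //.
  have [_ [f1 _] _] := hfv z.
  by have := f1 B mB; rewrite /pushforward => ->; exact: BA.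
have m2 A B : measurable A -> measurable B ->
    (forall z, dh (f (v z)).2.2 B <= dh z.2 A) -> m (snd @^-1` B) <= dH Y A.
  move=> mA mB BA.
  rewrite mE; last by rewrite -[X in measurable X]setTI; exact: measurable_snd.
  rewrite dHE// -(integral_coupling_snd cg (@measurable_dh R Y _ mA))//.
  apply: ge0_le_lower_integral => z //.
  have [_ [_ f2] _] := hfv z.
  by have := f2 B mB; rewrite /pushforward => ->; exact: BA.
exists m; split.
- rewrite mE; last exact: measurable_square.
  transitivity (\int[gamma]_z (cst 1 z)).
    apply: eq_integral => z _; have [_ cp _] := hfv z.
    by apply: (coupling_square cp); exact: dh_itv.
  by rewrite integral_cst// mul1e; exact: probability_setT.
- have mcE : measurable_fun [set: R * R] (fun z => (c z)%:E).
    exact/measurable_EFinP.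
  rewrite mI//.
  pose g z := \int[(f (v z)).1]_y (c y)%:E.
  have mg : measurable_fun setT g.
    have mn : measurable_fun [set: nat] (fun n => \int[(f n).1]_y (c y)%:E) by [].
    exact: (measurableT_comp mn mv).
  have g0 z : 0 <= g z by apply: integral_ge0 => y _; rewrite lee_fin.
  (* The transport cost may not be measurable: subtract [e] from [g] instead of
     adding it to the cost, so that additivity is used for [g] only. *)
  apply: (@le_trans _ _ (\int[gamma]_z (maxe (g z - e%:E) 0 + e%:E))).
    apply: ge0_le_lower_integral => z; first exact: g0.
    by rewrite -leeBlDr// le_max lexx.
  have mge : measurable_fun setT (fun z => maxe (g z - e%:E) 0).
    by apply: measurable_maxe => //; apply: emeasurable_funB.
  rewrite ge0_integralD//; last 2 first.
  + by move=> z _; rewrite le_max lexx orbT.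
  + by move=> z _; rewrite lee_fin ltW.
  rewrite integral_cst// [X in _ * X](_ : _ = 1); last exact: probability_setT.
  rewrite mule1 EFinD leeD2r//; apply: le_trans hV.
  apply: ge0_le_lower_integral => z; first by rewrite le_max lexx orbT.
  rewrite ge_max; apply/andP; split; last exact: transport_cost_ge0.
  rewrite leeBlDr//.
  by have [_ _] := hfv z; exact.
- move=> a b ab; split; apply: m1 => // z.
    exact: dh_rray_le (near1 z) ab.
  exact: dh_lray_le (near1 z) ab.
- move=> a b ab; split; apply: m2 => // z.
    exact: dh_rray_le (near2 z) ab.
  exact: dh_lray_le (near2 z) ab.
Qed.

End fixed_cost.

(** The limit of the approximate gluings for e = 1 / (k + 1), along an
    ultrafilter containing the neighbourhoods of infinity. *)
Lemma glued_coupling (c : R * R -> R) (M : R) X Y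
    (gamma : probability (borel X * borel Y)%type R) (V : R) :
  (forall z, (0 <= c z <= M)%R) ->
  (forall t : R, (0 <= t)%R -> open [set z | (t < c z)%R]) ->
  coupling (mm_measure X) (mm_measure Y) gamma ->
  \int[gamma]_z transport_cost c (dh (z.1 : X)) (dh (z.2 : Y)) <= V%:E ->
  exists2 P : probability (R * R)%type R, coupling (dH X) (dH Y) P &
    \int[P]_z (c z)%:E <= V%:E.
Proof.
move=> cM lc cg hV.
have [D [D0 hX hY]] := mdist_bounded X Y.
have mc : measurable_fun [set: R * R] c.
  by apply: measurable_lsc_plane => // z; have /andP[] := cM z.
have en0 (k : nat) : (0 < k.+1%:R^-1 :> R)%R by rewrite invr_gt0.
have /choice[pi hpi] := fun k => approx_glued_coupling cM mc cg hX hY hV (en0 k).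
have [U [uU Uoo]] := @ultraFilterLemma nat \oo _.
have small (e : R) : (0 < e)%R -> \forall k \near U, (k.+1%:R^-1 < e)%R.
  by move=> e0; apply: Uoo; exact: near_infty_natSinv_lt (PosNum e0).
have [P PU] := probability_ultralimit uU (@compact_square R D)
  (fun k => let: And4 h _ _ _ := hpi k in h).
exists P.
  split => A mA; rewrite /pushforward.
  - apply: (ultralimit_marginal uU PU) => // [z|a b ab|a b ab].
    + exact: cvg_fst.
    + apply: filterS (small (b - a)%R _) => [k kab|]; last by rewrite subr_gt0.
      have abk : (a + k.+1%:R^-1 <= b)%R by rewrite -lerBrDl ltW.
      by have [_ _ h _] := hpi k; have [] := h a b abk.
    + apply: filterS (small (b - a)%R _) => [k kab|]; last by rewrite subr_gt0.
      have abk : (a + k.+1%:R^-1 <= b)%R by rewrite -lerBrDl ltW.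
      by have [_ _ h _] := hpi k; have [] := h a b abk.
  - apply: (ultralimit_marginal uU PU) => // [z|a b ab|a b ab].
    + exact: cvg_snd.
    + apply: filterS (small (b - a)%R _) => [k kab|]; last by rewrite subr_gt0.
      have abk : (a + k.+1%:R^-1 <= b)%R by rewrite -lerBrDl ltW.
      by have [_ _ _ h] := hpi k; have [] := h a b abk.
    + apply: filterS (small (b - a)%R _) => [k kab|]; last by rewrite subr_gt0.
      have abk : (a + k.+1%:R^-1 <= b)%R by rewrite -lerBrDl ltW.
      by have [_ _ _ h] := hpi k; have [] := h a b abk.
apply: (ultralimit_integral uU PU cM lc) => e e0.
apply: filterS (small e e0) => k ke; have [_ + _ _] := hpi k.
by move/le_trans; apply; rewrite lee_fin lerD2l ltW.
Qed.

End gluing.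

(** * The third lower bound dominates the second *)

Section second_inequality.
Context {R : realType}.
Implicit Types (X Y : mmspace R) (p q : \bar R) (alpha beta : probability R R).

Lemma transport_cost_le_wasserstein alpha beta q (D r : R) : (0 < r)%R ->
  alpha `[0%R, D]%classic = 1 -> beta `[0%R, D]%classic = 1 ->
  transport_cost (clip_cost q D r) alpha beta <=
  (wasserstein r%:E q alpha beta) `^ r.
Proof.
move=> r0 aD bD.
have t0 : 0 <= transport_cost (clip_cost q D r) alpha beta.
  by apply: transport_cost_ge0 => z; exact: clip_cost_ge0.
rewrite -[leLHS](poweRVK r0 t0); apply: le_poweR; [exact: ltW|exact: poweR_ge0|].
apply: le_ereal_inf_tmp => _ [pi cpi <-].
rewrite (integral_clip_cost _ _ (coupling_square cpi aD bD)).
apply: le_poweR => //; first by rewrite invr_ge0 ltW.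
by apply: ereal_inf_lbound; exists pi.
Qed.

Lemma wassersteiny_ge0 alpha beta q (D : R) :
  alpha `[0%R, D]%classic = 1 -> beta `[0%R, D]%classic = 1 ->
  0 <= wasserstein +oo q alpha beta.
Proof.
move=> aD bD; apply: le_ereal_inf_tmp => _ [pi cpi <-].
have piD := coupling_square cpi aD bD.
have [z Sz] := supp_neq0 (supp_plane_full pi).
have qz := square_quadrant (supp_square piD Sz).
apply: le_trans (ereal_sup_ubound _); last by exists z.
rewrite lee_fin; apply: Lambda_ge0.
  by case: qz; rewrite /= in_itv/= andbT.
by case: qz => _; rewrite /= in_itv/= andbT.
Qed.

Lemma SLB_le_TLB_cost X Y q (r : R)
    (gamma : probability (borel X * borel Y)%type R) : 1 <= q -> (1 <= r)%R ->
  coupling (mm_measure X) (mm_measure Y) gamma ->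
  SLB r%:E q X Y <=
  (\int[gamma]_z (wasserstein r%:E q (dh (z.1 : X)) (dh (z.2 : Y))) `^ r) `^ r^-1.
Proof.
move=> q1 r1 cg; set V := (X in X `^ _).
have r0 : (0 < r)%R by exact: lt_le_trans r1.
have rV0 : (0 < r^-1)%R by rewrite invr_gt0.
have V0 : 0 <= V by apply: integral_ge0 => z _; exact: poweR_ge0.
have [D [D0 hX hY]] := mdist_bounded X Y.
have [->|Vy] := eqVneq V +oo; first by rewrite poweRyr ?leey// gt_eqF.
have VE : V = (fine V)%:E by rewrite fineK// ge0_fin_numE// ltey.
have [|||P cP Pc] := @glued_coupling R (clip_cost q D r) (D `^ r) X Y gamma (fine V) _ _ cg.
- by move=> z; rewrite clip_cost_ge0 clip_cost_le// ltW.
- by move=> t t0; exact: open_clip_cost.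
- rewrite -VE; apply: ge0_le_lower_integral => z.
    by apply: transport_cost_ge0 => y; exact: clip_cost_ge0.
  by apply: transport_cost_le_wasserstein => //; exact: dh_itv.
apply: ge_ereal_inf; eexists; first by exists P.
rewrite (integral_clip_cost _ _ (coupling_square cP (dH_itv hX) (dH_itv hY))).
apply: le_poweR; [exact: ltW| |by rewrite VE].
by apply: integral_ge0 => y _; rewrite lee_fin clip_cost_ge0.
Qed.

(** For a level [m] above the supremum, the local distributions at a point of the
    support of [gamma] have a coupling that does not charge the open set where
    [Lambda q] exceeds [m]: the transport cost for the indicator of this set
    vanishes [gamma]-almost everywhere, and gluing yields a coupling of the
    global distributions with the same property. *)
Lemma SLBy_le_TLBy_cost X Y q
    (gamma : probability (borel X * borel Y)%type R) : 1 <= q ->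
  coupling (mm_measure X) (mm_measure Y) gamma ->
  SLB +oo q X Y <=
  ereal_sup [set wasserstein +oo q (dh z.1) (dh z.2)
            | z in supp (gamma : set (X * Y) -> \bar R)].
Proof.
move=> q1 cg; set s := ereal_sup _.
have [cS S0] := supp_coupling gamma.
have [D [D0 hX hY]] := mdist_bounded X Y.
have s0 : 0 <= s.
  have [z Sz] := supp_neq0 S0.
  apply: le_trans (ereal_sup_ubound _); last by exists z.
  by apply: (@wassersteiny_ge0 _ _ _ D); exact: dh_itv.
have [->|sy] := eqVneq s +oo; first by rewrite leey.
have sfin : s \is a fin_num by rewrite ge0_fin_numE// ltey.
pose t := fine s; have sE : s = t%:E by rewrite fineK.
have t0 : (0 <= t)%R by rewrite fine_ge0.
apply/lee_addgt0Pr => e e0; rewrite sE -EFinD.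
pose m := (t + e)%R; have m0 : (0 <= m)%R by rewrite addr_ge0// ltW.
pose G := [set z : R * R | (m < Lambda q (clip D z.1) (clip D z.2))%R].
have oG : open G by exact: open_clip_Lambda.
have mG : measurable G by exact: open_measurable_plane.
pose c : R * R -> R := \1_G.
have [|||P cP Pc] := @glued_coupling R c 1 X Y gamma 0 _ _ cg.
- by move=> z; rewrite /c indicE; case: (z \in G); rewrite /= ?ler01 ?lexx.
- move=> u u0; have [u1|u1] := ltP u 1%R.
    rewrite (_ : [set z | _] = G)//; apply/seteqP; split => z /=.
      rewrite /c indicE; case: (boolP (z \in G)); rewrite ?inE//.
      by rewrite /= ltNge u0.
    by move=> Gz; rewrite /c indicE mem_set.
  rewrite (_ : [set z | _] = set0); first exact: open0.
  rewrite -subset0 => z /=; rewrite ltNge => /negP; apply; apply: le_trans u1.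
  by rewrite /c indicE; case: (z \in G).
- rewrite -[leRHS]S0 -[X in _ <= gamma X]setIT.
  have mS : measurable (~` supp (gamma : set (X * Y) -> \bar R) : set (borel X * borel Y)).
    apply: open_measurable_prod; [exact: mm_second_countable..|].
    exact/closed_openC/closed_supp.
  rewrite -integral_indic//; apply: ge0_le_lower_integral => z.
    by apply: transport_cost_ge0 => y; rewrite /c indicE.
  have [Sz|Sz] := pselect (supp (gamma : set (X * Y) -> \bar R) z); last first.
    rewrite indicE mem_set//.
    apply: ge_ereal_inf; eexists.
      by exists (dh (z.1 : X) \x dh (z.2 : Y))%E => //; exact: product_coupling.
    by rewrite integral_indic// setIT; exact: probability_le1.
  rewrite indicE memNset; last by [].
  have : wasserstein +oo q (dh (z.1 : X)) (dh (z.2 : Y)) < m%:E.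
    apply: (@le_lt_trans _ _ s); last by rewrite sE lte_fin ltrDl.
    by apply: ereal_sup_ubound; exists z.
  move=> /ereal_inf_lt[_ [pi cpi <-] pim].
  have piD := coupling_square cpi (dh_itv _ hX) (dh_itv _ hY).
  apply: ge_ereal_inf; eexists; first by exists pi.
  rewrite integral_indic// setIT.
  rewrite -[leRHS]/(0 : \bar R) -(supp_plane_full pi).
  apply: le_measure; rewrite ?inE//.
    by apply: open_measurable_plane; apply: closed_openC; exact: closed_supp.
  move=> y Gy Sy; have yD := supp_square piD Sy.
  have : (Lambda q y.1 y.2)%:E < m%:E.
    apply: le_lt_trans pim; apply: ereal_sup_ubound; exists y => //.
    by split => //; exact: square_quadrant yD.
  move: Gy yD; rewrite /G/= => Gy [/=]; rewrite !in_itv/= => y1 y2.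
  by move: Gy; rewrite !clip_id// lte_fin => /lt_trans/[apply]; rewrite ltxx.
have PD := coupling_square cP (dH_itv hX) (dH_itv hY).
apply: ge_ereal_inf; eexists; first by exists P.
apply: ge_ereal_sup => _ [z [Sz _] <-]; rewrite lee_fin leNgt; apply/negP => Gz.
have [z1 z2] := supp_square PD Sz.
have : 0 < P G.
  by apply: Sz; split => //; rewrite /G/= !clip_id.
by move: Pc; rewrite integral_indic// setIT leNgt => /negP.
Qed.

Lemma SLB_le_TLB p q X Y : 1 <= p -> 1 <= q -> SLB p q X Y <= TLB p q X Y.
Proof.
case: p => [r| |]// p1 q1; apply: le_ereal_inf_tmp => _ [gamma cg <-].
  exact: SLB_le_TLB_cost.
exact: SLBy_le_TLBy_cost.
Qed.

End second_inequality.

(** * The second lower bound dominates the diameter lower bound *)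

Section reverse_minkowski.
Context d (T : measurableType d) (R : realType) (mu : {measure set T -> \bar R}).

Lemma LnormEFin (h : T -> R) (s : R) :
  'N[mu]_s%:E[EFin \o h] = (\int[mu]_x (`|h x| `^ s)%:E) `^ s^-1.
Proof.
by rewrite unlock.
Qed.

(** The triangle inequality in L^s, applied to [f = (f - g) + g] and to
    [g = (g - f) + f]. *)
Lemma reverse_minkowski (f g : T -> R) (s : R) (F G : R) : (1 <= s)%R ->
  measurable_fun setT f -> measurable_fun setT g ->
  (\int[mu]_x (`|f x| `^ s)%:E) `^ s^-1 = F%:E ->
  (\int[mu]_x (`|g x| `^ s)%:E) `^ s^-1 = G%:E ->
  `|F - G|%:E <= (\int[mu]_x (`|f x - g x| `^ s)%:E) `^ s^-1.
Proof.
move=> s1 mf mg fF gG.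
have half (u v : T -> R) (A B : R) : measurable_fun setT u ->
    measurable_fun setT v ->
    (\int[mu]_x (`|u x| `^ s)%:E) `^ s^-1 = A%:E ->
    (\int[mu]_x (`|v x| `^ s)%:E) `^ s^-1 = B%:E ->
    (A - B)%:E <= (\int[mu]_x (`|u x - v x| `^ s)%:E) `^ s^-1.
  move=> mfu mv uA vB.
  have mNv : measurable_fun setT (fun x => - v x)%R.
    exact: (measurableT_comp (@oppr_measurable R _) mv).
  have uN : 'N[mu]_s%:E[EFin \o u] = A%:E := etrans (LnormEFin u s) uA.
  have vN : 'N[mu]_s%:E[EFin \o (fun x => - v x)%R] = B%:E.
    apply: etrans vB; rewrite (LnormEFin (fun x => - v x)%R); congr (_ `^ _).
    by apply: eq_integral => x _; rewrite normrN.
  have := lerB_LnormD mu mfu mNv s1; rewrite uN vN.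
  by move/le_trans; apply; rewrite (LnormEFin (u \+ (fun x => - v x))%R).
have h1 := half _ _ _ _ mf mg fF gG.
have := half _ _ _ _ mg mf gG fF.
under eq_integral do rewrite distrC.
by move=> h2; have [?|?] := leP 0%R (F - G)%R;
  [rewrite ger0_norm|rewrite ltr0_norm// opprB].
Qed.

End reverse_minkowski.

Section third_inequality.
Context {R : realType}.
Implicit Types (X Y : mmspace R) (p q : \bar R).

(** [diam r] is the L^r norm of the identity under [dH X], by a change of
    variables and Tonelli's theorem. Clipping at [D] changes nothing on the range
    of the distance. *)
Lemma diam_cost X (D r : R) : (0 < r)%R -> (forall x x' : X, (mdist x x' <= D)%R) ->
  diam r%:E X = (\int[dH X]_a (clip D a `^ r)%:E) `^ r^-1.
Proof.
move=> r0 hX; rewrite /diam; congr (_ `^ _).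
have mc : measurable_fun setT (fun a : R => (clip D a `^ r)%:E).
  apply/measurable_EFinP; apply: (measurableT_comp (measurable_powR _)).
  by apply: measurable_maxr => //; apply: measurable_minr.
rewrite ge0_integral_distribution//; last by move=> a; rewrite lee_fin powR_ge0.
rewrite fubini_tonelli1/=; last 2 first.
- apply: (measurableT_comp mc); exact: measurable_mdist (@mm_compact R X).
- by move=> z; rewrite lee_fin powR_ge0.
apply: eq_integral => x _; apply: eq_integral => x' _ /=.
by rewrite /dist_pair/= clip_id// mdist_ge0 hX.
Qed.

Lemma diam_fin_num X (r : R) : (1 <= r)%R -> diam r%:E X \is a fin_num.
Proof.
move=> r1; have r0 : (0 < r)%R by exact: lt_le_trans r1.
have [D [D0 hX _]] := mdist_bounded X X.
rewrite (diam_cost r0 hX); apply: fin_num_poweR.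
rewrite ge0_fin_numE; last by apply: integral_ge0 => a _; rewrite lee_fin powR_ge0.
apply: (@le_lt_trans _ _ (\int[dH X]_a (cst (D `^ r)%:E a))).
  apply: ge0_le_lower_integral => a; rewrite lee_fin; first exact: powR_ge0.
  by apply: ler_powR_nneg; rewrite ?clip_ge0 ?clip_le// ltW.
rewrite integral_cst// [X in _ * X](_ : _ = 1) ?mule1 ?ltry//.
exact: probability_setT.
Qed.

(** With [m = min r q] and [s = r / m >= 1], the norm of [a |-> a ^ m] in L^s is
    the m-th power of its norm in L^r, that is of [diam r]. *)
Lemma DLB_le_SLB_fin X Y q (r : R) : (1 <= r)%R -> 1 <= q ->
  DLB r%:E (mine r%:E q) X Y <= SLB r%:E q X Y.
Proof.
move=> r1 q1; have r0 : (0 < r)%R by exact: lt_le_trans r1.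
have [D [D0 hX hY]] := mdist_bounded X Y.
apply: le_ereal_inf_tmp => _ [pi cpi <-].
rewrite (integral_clip_cost _ _ (coupling_square cpi (dH_itv hX) (dH_itv hY))).
have [m [m1 mE mq]] : exists m : R, [/\ (1 <= m <= r)%R, mine r%:E q = m%:E & m%:E <= q].
  case: q q1 => [q| |]// q1; last first.
    by exists r; rewrite r1 lexx leey miney.
  rewrite lee_fin in q1; exists (Num.min r q); split.
  - by rewrite le_min r1 q1 ge_min lexx.
  - by rewrite EFin_min.
  - by rewrite lee_fin ge_min lexx orbT.
have /andP[m1' mr] := m1.
have m0 : (0 < m)%R by exact: lt_le_trans m1'.
pose s := (r / m)%R.
have s1 : (1 <= s)%R by rewrite ler_pdivlMr// mul1r.
have s0 : (0 < s)%R by exact: lt_le_trans s1.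
pose f (z : R * R) : R := (clip D z.1 `^ m)%R.
pose g (z : R * R) : R := (clip D z.2 `^ m)%R.
have mclip : measurable_fun setT (clip D).
  by apply: measurable_maxr => //; apply: measurable_minr.
have mf : measurable_fun setT f.
  apply: (measurableT_comp (measurable_powR _)).
  exact: (measurableT_comp mclip measurable_fst).
have mg : measurable_fun setT g.
  apply: (measurableT_comp (measurable_powR _)).
  exact: (measurableT_comp mclip measurable_snd).
have norm_diam (Z : mmspace R) (h : R * R -> R) : measurable_fun setT h ->
    (forall x x' : Z, (mdist x x' <= D)%R) ->
    (forall A, measurable A -> pi (h @^-1` A) = dH Z A) ->
    (\int[pi]_z (`|(clip D (h z) `^ m)%R| `^ s)%:E) `^ s^-1 =
    ((fine (diam r%:E Z)) `^ m)%R%:E.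
  move=> mh hZ pih.
  rewrite (_ : \int[pi]_z _ = \int[dH Z]_a (clip D a `^ r)%:E).
    rewrite -poweR_EFin fineK ?diam_fin_num// (diam_cost r0 hZ) -poweRrM.
    by rewrite /s invf_div mulrC.
  transitivity (\int[pushforward pi h]_a (clip D a `^ r)%:E).
    rewrite ge0_integral_pushforward; [|exact: mh|exact: measurableT| |].
    - apply: eq_integral => z _ /=; rewrite ger0_norm ?powR_ge0// -powRrM /s.
      by rewrite mulrCA divff ?mulr1// gt_eqF.
    - apply/measurable_EFinP; exact: (measurableT_comp (measurable_powR _) mclip).
    - by move=> y _; rewrite lee_fin powR_ge0.
  by apply: eq_measure_integral => A mA _; exact: pih.
have [pi1 pi2] := cpi.
have := reverse_minkowski s1 mf mg
  (norm_diam X fst measurable_fst hX pi1) (norm_diam Y snd measurable_snd hY pi2).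
set N := \int[pi]_z _ => FG.
have N0 : 0 <= N by apply: integral_ge0 => z _; rewrite lee_fin powR_ge0.
rewrite /DLB mE /=; apply: (@le_trans _ _ (N `^ r^-1)).
  rewrite (_ : N `^ r^-1 = (N `^ s^-1) `^ m^-1).
    rewrite -poweR_EFin; apply: le_poweR; [by rewrite invr_ge0 ltW| |exact: FG].
    by rewrite lee_fin.
  by rewrite -poweRrM /s invf_div mulrAC divff ?mul1r// gt_eqF.
apply: le_poweR; [by rewrite invr_ge0 ltW|exact: N0|].
apply: ge0_le_lower_integral => z; rewrite lee_fin; first exact: powR_ge0.
rewrite /clip_cost (_ : _ `^ s = (Lambda m%:E (clip D z.1) (clip D z.2)) `^ r)%R.
  apply: ler_powR_nneg; [exact: ltW|apply: Lambda_ge0; exact: clip_ge0|].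
  by apply: le_Lambda => //; exact: clip_ge0.
by rewrite /Lambda/= -powRrM /s mulrC.
Qed.

Lemma diamy_attained X (x0 x1 : X) :
  (forall x x' : X, (mdist x x' <= mdist x0 x1)%R) ->
  diam +oo X = (mdist x0 x1)%:E.
Proof.
move=> h; rewrite /diam mm_supp; apply/eqP; rewrite eq_le; apply/andP; split.
  by apply: ge_ereal_sup => _ [z _ <-]; rewrite lee_fin.
by apply: ereal_sup_ubound; exists (x0, x1).
Qed.

(** A neighbourhood of the distance pulls back to a set containing a product of
    two open sets, each of positive mass as [mm_measure X] has full support. *)
Lemma mdist_supp_dH X (x0 x1 : X) : supp (dH X : set R -> \bar R) (mdist x0 x1).
Proof.
move=> U [oU Ux].
have : nbhs (x0, x1) ((fun z : X * X => mdist z.1 z.2) @^-1` U).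
  by apply: continuous_mdist; exact: open_nbhs_nbhs.
move=> [[V W]/= [Vx Wx] VWU].
have pos (x : X) A : nbhs x A -> exists B : set X, [/\ open B, B `<=` A & 0 < mm_measure X B].
  rewrite nbhsE => -[B oB BA]; exists B; split => //; first by case: oB.
  have : supp (mm_measure X : set X -> \bar R) x by rewrite mm_supp.
  exact.
have [V' [oV V'V V0]] := pos _ _ Vx.
have [W' [oW W'W W0]] := pos _ _ Wx.
have mV := open_measurable_borel oV.
have mW := open_measurable_borel oW.
apply: (@lt_le_trans _ _ ((mm_measure X \x mm_measure X)%E (V' `*` W'))).
  by rewrite product_measure1E// mule_gt0.
apply: (@le_measure _ _ _ (mm_measure X \x mm_measure X)%E); rewrite ?inE.
- exact: measurableX.
- apply: (measurable_funPTI (@dist_pair R X)); exact: open_measurable.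
- by move=> -[a b] [/= /V'V ? /W'W ?]; exact: (VWU (a, b)).
Qed.

(** Say that [X] has the larger diameter. This diameter is attained, so that it
    belongs to the support of [dH X], hence it is the first coordinate of a point [z] in the support of the
    coupling; the second coordinate of [z] is at most the diameter of [Y]. Then
    [Lambda q z.1 z.2] can only decrease when [z.2] is raised to the diameter of
    [Y]. *)
Lemma DLBy_le_SLBy X Y q : 1 <= q -> DLB +oo q X Y <= SLB +oo q X Y.
Proof.
move=> q1.
have [x0 [x1 hx]] := mdist_max X; have [y0 [y1 hy]] := mdist_max Y.
have [D [D0 hX hY]] := mdist_bounded X Y.
rewrite /DLB (diamy_attained hx) (diamy_attained hy)/=.
apply: le_ereal_inf_tmp => _ [pi cpi <-].
have piD := coupling_square cpi (dH_itv hX) (dH_itv hY).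
have sD := supp_square piD; have s1 := supp_plane_full pi.
have [pi1 pi2] := cpi.
pose S := supp (pi : set (R * R) -> \bar R).
have cS : compact S.
  by apply: subclosed_compact (@compact_square R D) sD; exact: closed_supp.
have lift (Z : mmspace R) (h : R * R -> R) (z0 z1 : Z) : continuous h ->
    (forall A, measurable A -> pi (h @^-1` A) = dH Z A) ->
    exists2 z, S z & h z = mdist z0 z1.
  move=> ch pih.
  have [|||z Sz hz] := @supp_pushforward_sub R (R * R)%type R h pi (dH Z) _ ch cS s1
    _ _ _ (@mdist_supp_dH Z z0 z1).
  - exact: Rhausdorff.
  - by move=> A B oA oB AB; apply: le_measure => //; rewrite inE; exact: open_measurable_plane.
  - by move=> A oA; rewrite pih//; exact: open_measurable.
  - by exists z.
have bound (Z : mmspace R) (h : R * R -> R) (z0 z1 : Z) : continuous h ->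
    (forall z z' : Z, mdist z z' <= mdist z0 z1)%R ->
    (forall A, measurable A -> pi (h @^-1` A) = dH Z A) ->
    forall z, S z -> (h z <= mdist z0 z1)%R.
  move=> ch hz pih z Sz; rewrite leNgt; apply/negP => zlt.
  have : 0 < pi (h @^-1` `]mdist z0 z1, +oo[%classic).
    apply: Sz; split; last by rewrite /= in_itv/= zlt.
    by move/continuousP : ch; apply; exact: interval_open.
  rewrite pih// -(setCitvl (BRight (mdist z0 z1))) probability_setC//.
  rewrite (_ : dH Z _ = 1) ?subee ?ltxx//; apply/eqP.
  rewrite eq_le probability_le1//= -(dH_itv hz); apply: le_measure; rewrite ?inE//.
  by move=> a; rewrite /= !in_itv/= => /andP[].
have quad z : S z -> [/\ quadrant z, (0 <= z.1)%R & (0 <= z.2)%R].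
  move=> /sD Sz; have [z1 z2] := square_quadrant Sz; split => //.
    by move: z1; rewrite /= in_itv/= andbT.
  by move: z2; rewrite /= in_itv/= andbT.
have cfst : continuous (fst : R * R -> R) by move=> z; exact: cvg_fst.
have csnd : continuous (snd : R * R -> R) by move=> z; exact: cvg_snd.
have [yx|xy] := leP (mdist y0 y1) (mdist x0 x1).
  have [z Sz z1E] := lift X fst x0 x1 cfst pi1.
  have z2y := bound Y snd y0 y1 csnd hy pi2 z Sz.
  have [qz z10 z20] := quad z Sz.
  apply: le_trans (ereal_sup_ubound _); last by exists z.
  by rewrite lee_fin z1E; apply: Lambda_antimono.
have [z Sz z2E] := lift Y snd y0 y1 csnd pi2.
have z1x := bound X fst x0 x1 cfst hx pi1 z Sz.
have [qz z10 z20] := quad z Sz.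
apply: le_trans (ereal_sup_ubound _); last by exists z.
rewrite lee_fin z2E Lambda_sym [leRHS]Lambda_sym.
by apply: Lambda_antimono => //; exact: ltW.
Qed.

Lemma DLB_le_SLB p q X Y : 1 <= p -> 1 <= q -> DLB p (mine p q) X Y <= SLB p q X Y.
Proof.
case: p => [r| |]// p1 q1; first exact: DLB_le_SLB_fin.
by rewrite minye; exact: DLBy_le_SLBy.
Qed.

End third_inequality.

Theorem proposition3p10 (R : realType) (X Y : mmspace R) (p q : \bar R)
    (hp : 1 <= p) (hq : 1 <= q) :
  [/\ 2%:E * dGW p q X Y >= TLB p q X Y,
      TLB p q X Y >= SLB p q X Y
    & SLB p q X Y >= DLB p (mine p q) X Y].
Proof.
split; first exact: TLB_le_dGW.
  exact: SLB_le_TLB.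
exact: DLB_le_SLB.
Qed.
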